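(* Let $H$ be a complex Hilbert space and let $T$ be a bounded self-adjoint operator on $H$. The following are equivalent: (a) $T$ is essentially positive; (b) $T+K$ is positive for some compact operator $K$ on $H$; (c) $\liminf_{\alpha} \langle Tx_\alpha,x_\alpha\rangle \geq 0$ for every net $(x_\alpha)$ of unit vectors in $H$ such that $x_\alpha\to 0$ weakly.
   Context: $L(H)$ is the algebra of bounded operators on $H$ and $K(H)$ the ideal of compact operators. The spectrum of $T\in L(H)$ is $\sigma(T)=\{\lambda\in\mathbb{C}: T-\lambda \text{ is not invertible}\}$. An operator $T\in L(H)$ is Fredholm if both $\ker T$ and $H/T(H)$ are finite-dimensional, and the essential spectrum is $\sigma_{\rm ess}(T)=\{\lambda\in\mathbb{C}: T-\lambda \text{ is not Fredholm}\}$. A self-adjoint $T\in L(H)$ is positive if $\sigma(T)\subset[0,\infty)$ (equivalently, $\langle Tx,x\rangle\ge 0$ for all $x\in H$), and essentially positive if $\sigma_{\rm ess}(T)\subset[0,\infty)$. A net $(x_\alpha)$ in $H$ converges weakly to $x\in H$ if $\lim_\alpha\langle x_\alpha,y\rangle=\langle x,y\rangle$ for all $y\in H$. *)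

(* Defs.v *)
From HB Require Import structures.
From mathcomp Require Import all_boot all_order all_algebra.
From mathcomp Require Import all_classical all_reals all_analysis.
From mathcomp Require Import complex.

Set Implicit Arguments.
Unset Strict Implicit.
Unset Printing Implicit Defensive.

Import Order.TTheory GRing.Theory Num.Theory.
Import numFieldNormedType.Exports.

Local Open Scope classical_set_scope.
Local Open Scope ring_scope.
Local Open Scope complex_scope.

(* Inner products are linear in the first variable and conjugate-linear in
   the second one. *)
HB.mixin Record hasInnerProduct (R : realType) H of
    CompleteNormedModule R[i] H := {
  inner : {dot H for (@Num.conj R[i])} ;
  sqr_normE : forall x : H, `|x| ^+ 2 = inner x x
}.

#[short(type="hilbertType")]
HB.structure Definition Hilbert (R : realType) :=
  {H of CompleteNormedModule R[i] H & hasInnerProduct R H}.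

Notation "'[< x , y >]" := (inner x y)
  (format "''[<' x ,  y >]") : ring_scope.

Section Operators.
Context {R : realType} {H : hilbertType R}.
Implicit Types (A T K : {linear H -> H}) (E W : set H).

Definition bounded_operator A :=
  exists M : R, forall x, `|A x| <= M%:C * `|x|.

Definition selfadjoint A := forall x y, '[< A x, y >] = '[< x, A y >].

Definition compact_operator K :=
  bounded_operator K /\ precompact (K @` [set x | `|x| <= 1]).

Definition invertible_operator A :=
  exists S : {linear H -> H},
    [/\ bounded_operator S, cancel A S & cancel S A].

Definition spectrum T : set R[i] :=
  [set l | ~ invertible_operator (T \- l \*: idfun)].

(* For subspaces W of E: the quotient E / W is spanned by the classes of
   finitely many elements of E. *)
Definition finite_dim_quotient E W :=
  exists n (v : 'I_n -> H), (forall i, E (v i)) /\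
    forall x, E x -> exists c : 'I_n -> R[i], W (x - \sum_(i < n) c i *: v i).

Definition fredholm A :=
  finite_dim_quotient [set x | A x = 0] [set 0] /\
  finite_dim_quotient setT (range A).

Definition ess_spectrum T : set R[i] :=
  [set l | ~ fredholm (T \- l \*: idfun)].

(* In the partial order of R[i], 0 <= z means that z is real and
   nonnegative. *)
Definition positive T :=
  selfadjoint T /\ spectrum T `<=` [set z | 0 <= z].

Definition essentially_positive T :=
  selfadjoint T /\ ess_spectrum T `<=` [set z | 0 <= z].

End Operators.

Section Nets.
Context {I : Type} (le : I -> I -> Prop).

Definition directed :=
  [/\ inhabited I, (forall a, le a a),
      (forall a b c, le a b -> le b c -> le a c)
    & (forall a b, exists c, le a c /\ le b c)].

(* The filter generated by the tails of a net indexed by I. *)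
Definition tails : set_system I :=
  [set P | exists a, forall b, le a b -> P b].

Definition net_liminf {R : realType} (u : I -> \bar R) : \bar R :=
  ereal_sup [set ereal_inf (u @` [set b | le a b]) | a in setT].

Definition weak_cvg {R : realType} {H : hilbertType R} (x : I -> H) (l : H) :=
  forall y, (fun a => '[< x a, y >]) @ tails --> '[< l, y >].

End Nets.

(* Main.v *)
From HB Require Import structures.
Require Import Defs.
From mathcomp Require Import all_boot all_order all_algebra.
From mathcomp Require Import all_classical all_reals all_analysis.
From mathcomp Require Import complex ring lra.

Set Implicit Arguments.
Unset Strict Implicit.
Unset Printing Implicit Defensive.

Import Order.TTheory GRing.Theory Num.Theory.
Import numFieldNormedType.Exports.

Local Open Scope classical_set_scope.
Local Open Scope ring_scope.
Local Open Scope complex_scope.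

(** All three conditions are compared with a fourth one, about the quadratic
    form alone: for every [e > 0] there is a finite set [F] such that
    [<Tx, x> >= - e |x|^2] for all [x] orthogonal to [F]
    ([ess_bounded_below T (- e)]).

    From (a) to the fourth condition.  Let [m] be the supremum of the numbers that
    bound the form from below on some space of finite codimension, and suppose
    [m < 0].  Then [T - m] is Fredholm, and the
    uniform boundedness principle turns the finite codimension of its range
    into an estimate [|y| <= C (|(T - m) y| + sum_v |<y, v>|)], with [v] in a
    finite list [V] ([cofinite_range_estimate]).  On the other hand, by
    maximality of [m] there are unit vectors [x] orthogonal to any prescribed
    finite set for which [<Tx, x>] is close to [m]; for those the
    Cauchy-Schwarz inequality of a nonnegative form makes [(T - m) x] small
    ([psd_rnorm_le]), which contradicts the estimate.

    From (a) to (b).  Let [S] be the span of the eigenvectors of [T] with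
    negative eigenvalue, [P] the projection onto its closure, and
    [K = - T P], so that [T + K = T (1 - P)].  The form of [T] is nonnegative
    on the orthogonal of [S]: a negative infimum would be attained, because of
    the same estimate, at an eigenvector which belongs both to [S] and to its
    orthogonal ([nonneg_orth_neg_eigenvectors]).  It is nonpositive on the
    closure of [S], so [K] is nonnegative, and the fourth condition gives
    [|Kx|^2 <= |K| <Kx, x> <= e |K| |x|^2] on a space of finite codimension,
    whence [K] is compact ([compact_of_small_orth]).

    From (b) to (c).  A compact self-adjoint [K] maps weakly null nets of unit
    vectors to norm null nets, and [T + K], having its spectrum in the
    half-line, has a nonnegative form: a negative infimum would be an
    eigenvalue.

    From (c) to (a).  When the fourth condition fails, choosing a bad unit
    vector for each finite list [F] defines a net, indexed by the finite
    lists, which contradicts (c).  When it holds, let [P] be the projection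
    onto the orthogonal of [F].  The compression [P T P] has a form bounded
    below by [- e] on the whole space, so [P T P - l] is invertible for [l] not
    real or [l < - e], and [T - l] differs from it by an operator of finite
    rank, hence is Fredholm. *)

(** * The real inner product space underlying a complex Hilbert space *)

Section RealLayer.
Context {R : realType} {H : hilbertType R}.
Implicit Types (x y z : H) (t : R).

(** The norm of [H] takes its values in [R[i]]; estimates are easier to
    carry out with real numbers. *)
Definition rnorm x : R := complex.Re `|x|.

(** [H] as a real inner product space. The imaginary part of the complex
    inner product is recovered by [inner_rdot]. *)
Definition rdot x y : R := complex.Re '[< x, y >].

Lemma normC_rnorm x : `|x| = (rnorm x)%:C.
Proof. by rewrite RRe_real // normr_real. Qed.

Lemma rnorm_ge0 x : 0 <= rnorm x.
Proof. by have := normr_ge0 x; rewrite normC_rnorm lecR. Qed.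

Lemma rnorm_sqr x : rnorm x ^+ 2 = rdot x x.
Proof.
rewrite /rdot -sqr_normE normC_rnorm.
by rewrite -rmorphXn.
Qed.

Lemma rnorm0_eq0 x : rnorm x = 0 -> x = 0.
Proof. by move=> x0; apply: normr0_eq0; rewrite normC_rnorm x0. Qed.

Lemma rnorm0 : rnorm 0 = 0.
Proof. by rewrite /rnorm normr0. Qed.

Lemma rnormN x : rnorm (- x) = rnorm x.
Proof. by rewrite /rnorm normrN. Qed.

Lemma rnormB x y : rnorm (x - y) = rnorm (y - x).
Proof. by rewrite /rnorm distrC. Qed.

Lemma rnormD x y : rnorm (x + y) <= rnorm x + rnorm y.
Proof. by have := ler_normD x y; rewrite !normC_rnorm -rmorphD lecR. Qed.

Lemma rnorm_tri x y z : rnorm (x - z) <= rnorm (x - y) + rnorm (y - z).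
Proof. by rewrite -[x - z](subrKA y) rnormD. Qed.

Lemma rnormZ t x : rnorm (t%:C *: x) = `|t| * rnorm x.
Proof.
have : `|t%:C *: x| = `|t|%:C * `|x|.
  by rewrite normrZ normc_def /= expr0n /= addr0 sqrtr_sqr.
by rewrite !normC_rnorm -rmorphM => /(congr1 (@complex.Re R)).
Qed.

Lemma rdotDl x y z : rdot (x + y) z = rdot x z + rdot y z.
Proof. by rewrite /rdot linearDl raddfD. Qed.

Lemma rdotDr x y z : rdot z (x + y) = rdot z x + rdot z y.
Proof. by rewrite /rdot linearDr raddfD. Qed.

Lemma rdotNl x z : rdot (- x) z = - rdot x z.
Proof. by rewrite /rdot linearNl raddfN. Qed.

Lemma rdotNr x z : rdot z (- x) = - rdot z x.
Proof. by rewrite /rdot linearNr raddfN. Qed.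

Lemma rdotBl x y z : rdot (x - y) z = rdot x z - rdot y z.
Proof. by rewrite rdotDl rdotNl. Qed.

Lemma rdotBr x y z : rdot z (x - y) = rdot z x - rdot z y.
Proof. by rewrite rdotDr rdotNr. Qed.

Lemma rdotZl t x z : rdot (t%:C *: x) z = t * rdot x z.
Proof.
rewrite /rdot linearZl_LR /=; case: (inner x z) => a b /=.
by rewrite mul0r subr0.
Qed.

Lemma innerC x y : '[< y, x >] = ('[< x, y >])^*%C.
Proof. by rewrite hermC /= expr0 mul1r. Qed.

Lemma rdotC x y : rdot x y = rdot y x.
Proof. by rewrite /rdot innerC; case: (inner y x). Qed.

Lemma rdotZr t x z : rdot z (t%:C *: x) = t * rdot z x.
Proof. by rewrite rdotC rdotZl rdotC. Qed.

Lemma rdot0l z : rdot 0 z = 0.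
Proof. by rewrite /rdot linear0l. Qed.

Lemma rdot0r z : rdot z 0 = 0.
Proof. by rewrite rdotC rdot0l. Qed.

Lemma rdot_sumr x I (r : seq I) (E : I -> H) :
  rdot x (\sum_(i <- r) E i) = \sum_(i <- r) rdot x (E i).
Proof.
by elim/big_rec2: _ => [|i a b _ <-]; rewrite ?rdot0r ?rdotDr.
Qed.

Lemma rdot_suml x I (r : seq I) (E : I -> H) :
  rdot (\sum_(i <- r) E i) x = \sum_(i <- r) rdot (E i) x.
Proof. by rewrite rdotC rdot_sumr; apply: eq_bigr => i _; rewrite rdotC. Qed.

Lemma inner_rdot x y : '[< x, y >] = rdot x y +i* rdot x ('i *: y).
Proof.
rewrite /rdot linearZr_LR /=; case: (inner x y) => a b /=.
by rewrite !mul0r mulN1r opprK add0r.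
Qed.

Lemma inner0C x y : '[< x, y >] = 0 -> '[< y, x >] = 0.
Proof. by move=> xy; rewrite innerC xy conjc0. Qed.

Lemma rdot_inner0 x y : '[< x, y >] = 0 -> rdot x y = 0.
Proof. by rewrite /rdot => ->. Qed.

(** Nonpositivity of the discriminant: the source of every
    Cauchy-Schwarz inequality below. *)
Lemma quad_disc (a b c : R) : 0 <= c ->
  (forall t, 0 <= a + 2 * t * b + t ^+ 2 * c) -> b ^+ 2 <= a * c.
Proof.
move=> c0 h; case: (eqVneq c 0) => [c00|cn0].
  case: (eqVneq b 0) => [->|bn0]; first by rewrite c00 expr0n /= mulr0.
  have := h (- (a + 1) / (2 * b)).
  have -> : a + 2 * (- (a + 1) / (2 * b)) * b = -1 by field.
  by rewrite c00; lra.
have := h (- b / c).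
have -> : a + 2 * (- b / c) * b + (- b / c) ^+ 2 * c = (a * c - b ^+ 2) / c
  by field.
by rewrite pmulr_lge0 ?invr_gt0 ?lt_def ?cn0 // subr_ge0.
Qed.

Lemma rdot_CS x y : rdot x y ^+ 2 <= rnorm x ^+ 2 * rnorm y ^+ 2.
Proof.
apply: quad_disc => [|t]; first exact: sqr_ge0.
have := sqr_ge0 (rnorm (x + t%:C *: y)).
rewrite !rnorm_sqr rdotDl !rdotDr !rdotZl !rdotZr (rdotC y x).
lra.
Qed.

Lemma rdot_le x y : `|rdot x y| <= rnorm x * rnorm y.
Proof.
have xy0 : 0 <= rnorm x * rnorm y by rewrite mulr_ge0 ?rnorm_ge0.
by rewrite -(ler_pXn2r (n := 2)) ?nnegrE // real_normK ?num_real // exprMn rdot_CS.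
Qed.

Lemma rnormZi x : rnorm ('i *: x) = rnorm x.
Proof.
apply/eqP; rewrite -(eqrXn2 (n := 2)) ?rnorm_ge0 // !rnorm_sqr /rdot.
rewrite linearZl_LR linearZr_LR /=; case: (inner x x) => a b /=.
by rewrite /= ; apply/eqP; ring.
Qed.

Lemma rnorm_scale_le (c : R[i]) x :
  rnorm (c *: x) <= (`|complex.Re c| + `|complex.Im c|) * rnorm x.
Proof.
rewrite {1}[c]complexE scalerDl (le_trans (rnormD _ _)) // mulrDl rnormZ.
by rewrite -scalerA rnormZi rnormZ.
Qed.

End RealLayer.

(** * Completeness, orthogonal projection and invertibility *)

Section Completeness.
Context {R : realType} {H : hilbertType R}.
Implicit Types (x y z v w : H) (t : R) (A : {linear H -> H}).

Lemma complete_filter (F : set_system H) (FF : ProperFilter F) :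
  (forall e : R, 0 < e ->
     exists2 P, F P & forall x y, P x -> P y -> rnorm (x - y) <= e) ->
  exists l, forall e : R, 0 < e -> F [set x | rnorm (x - l) <= e].
Proof.
move=> Fc.
have ballE (x y : H) (e : R) : 0 < e -> ball x e%:C y <-> rnorm (x - y) < e.
  by move=> e0; rewrite -ball_normE /= normC_rnorm ltcR.
have /cauchy_cvg /cvg_ballP Fl : cauchy F.
  apply: cauchy_exP => e e0.
  have e1 : e = (complex.Re e)%:C by rewrite RRe_real // gtr0_real.
  have {}e0 : 0 < complex.Re e by rewrite -ltcR -e1.
  have [P FP Pe] := Fc (complex.Re e / 2) (divr_gt0 e0 (ltr0Sn _ 1)).
  have [x Px] := filter_ex FP.
  exists x; apply: filterS FP => y Py; rewrite e1; apply/ballE => //.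
  by apply: le_lt_trans (Pe _ _ Px Py) _; lra.
exists (lim F) => e e0.
have := Fl e%:C; rewrite ltcR => /(_ e0); apply: filterS => x /ballE => /(_ e0).
by rewrite rnormB => /ltW.
Qed.

(** Completeness in the form used for minimising sequences: [S d] is the
    set of approximate solutions with error [d]. *)
Lemma complete_family (S : R -> set H) :
  (forall d, 0 < d -> S d !=set0) ->
  (forall d d' x, d <= d' -> S d x -> S d' x) ->
  (forall e : R, 0 < e -> exists2 d, 0 < d &
     forall x y, S d x -> S d y -> rnorm (x - y) <= e) ->
  exists l, forall e : R, 0 < e -> exists2 d, 0 < d &
     forall x, S d x -> rnorm (x - l) <= e.
Proof.
move=> S0 Smono Sc; pose F := [set P | exists2 d : R, 0 < d & S d `<=` P].
have FF : ProperFilter F.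
  split=> [[d d0 Sd]|]; first by have [x /Sd] := S0 _ d0.
  split.
  - by exists 1 => //.
  - move=> P Q [d d0 SP] [d' d'0 SQ]; exists (Num.min d d').
      by rewrite lt_min d0.
    by move=> x Sx; split; [apply: SP|apply: SQ]; apply: Smono Sx;
      rewrite ge_min lexx ?orbT.
  - by move=> P Q PQ [d d0 SP]; exists d => // x /SP /PQ.
have [|l Fl] := complete_filter FF.
  move=> e e0; have [d d0 Sd] := Sc _ e0.
  by exists (S d) => //; exists d.
by exists l => e e0; have [d d0 Sd] := Fl _ e0; exists d.
Qed.

Definition subspace (S : set H) :=
  [/\ S 0, forall x y, S x -> S y -> S (x + y)
    & forall (c : R[i]) x, S x -> S (c *: x)].

(** Membership in the closure, stated with real radii. *)
Definition adherent (S : set H) x :=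
  forall e : R, 0 < e -> exists2 u, S u & rnorm (x - u) <= e.

Lemma small_eq0 (a M : R) : 0 <= M -> (forall e, 0 < e -> `|a| <= e * M) -> a = 0.
Proof.
move=> M0 h; apply/eqP; rewrite -normr_eq0 eq_le normr_ge0 andbT leNgt.
apply/negP => a0; have M2 : 0 < 2 * (M + 1) by lra.
have e0 : 0 < `|a| / (2 * (M + 1)) by rewrite divr_gt0.
have := h _ e0; have : `|a| = `|a| / (2 * (M + 1)) * (2 * (M + 1)).
  by rewrite divfK ?gt_eqF.
set e := _ / _ in e0 * => -> h1.
have := mulr_ge0 (ltW e0) M0; lra.
Qed.

Lemma parallelogram x y :
  rnorm (x + y) ^+ 2 + rnorm (x - y) ^+ 2 = 2 * rnorm x ^+ 2 + 2 * rnorm y ^+ 2.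
Proof.
rewrite !rnorm_sqr !rdotDl !rdotDr !rdotNl !rdotNr.
ring.
Qed.

Lemma inner_eq0_rdot (S : set H) v :
  subspace S -> (forall u, S u -> rdot v u = 0) -> forall u, S u -> '[< v, u >] = 0.
Proof.
by move=> [_ _ SZ] h u Su; rewrite inner_rdot !h //; apply: SZ.
Qed.

(** The near minimisers of the distance from [v] to [S] form a Cauchy
    family by the parallelogram law, and their limit is the foot of the
    perpendicular. Since [S] need not be closed, the foot is only adherent
    to [S]. *)
Lemma projection (S : set H) : subspace S -> forall v,
  exists2 w, adherent S w & forall u, S u -> '[< v - w, u >] = 0.
Proof.
move=> Ssub v; have [S0 SD SZ] := Ssub.
pose D := [set rnorm (v - u) ^+ 2 | u in S].
have D0 : has_inf D.
  split; first by exists (rnorm (v - 0) ^+ 2); exists 0.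
  by exists 0 => _ [u _ <-]; exact: sqr_ge0.
pose d := inf D.
have dS u : S u -> d <= rnorm (v - u) ^+ 2.
  by move=> Su; apply: ge_inf; [case: D0|exists u].
pose Sd (e : R) := [set u | S u /\ rnorm (v - u) ^+ 2 < d + e].
have [e e0|e e' x ee' [Sx xe]|e e0|w Hw] := @complete_family Sd.
- have [_ [u Su <-] ue] := inf_adherent e0 D0.
  by exists u.
- by split=> //; apply: lt_le_trans xe _; rewrite lerD2l.
- exists (e ^+ 2 / 4); first by rewrite divr_gt0 ?exprn_gt0.
  move=> x y [Sx xd] [Sy yd].
  have := parallelogram (v - x) (v - y).
  have -> : (v - x) - (v - y) = y - x by rewrite opprB addrC subrKA.
  have -> : (v - x) + (v - y) = 2%:C *: (v - (2^-1)%:C *: (x + y)).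
    rewrite scalerBr scalerA -rmorphM /= divff ?pnatr_eq0 // scale1r.
    rewrite rmorph_nat scaler_nat mulr2n.
    by rewrite opprD addrACA.
  rewrite rnormZ exprMn real_normK ?num_real // (rnormB y).
  rewrite -[_ <= e](ler_pXn2r (n := 2)) ?nnegrE ?rnorm_ge0 ?(ltW e0) //.
  have := dS _ (SZ ((2^-1)%:C) _ (SD _ _ Sx Sy)); move: xd yd.
  set q := rnorm (v - _ *: _) ^+ 2; lra.
- exists w => [e e0|].
    have [d' d'0 h] := Hw _ e0.
    have [_ [u Su <-] ue] := inf_adherent d'0 D0.
    by exists u => //; rewrite rnormB; apply: h.
  apply: inner_eq0_rdot => // u Su; apply: (@small_eq0 _ (2 * rnorm u)).
    by rewrite mulr_ge0 ?rnorm_ge0.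
  move=> e e0; have [d' d'0 h] := Hw _ e0.
  have m0 : 0 < Num.min d' (e ^+ 2) by rewrite lt_min d'0 exprn_gt0.
  have [_ [x Sx <-] xe] := inf_adherent m0 D0.
  have xw : rnorm (x - w) <= e.
    by apply: h; split => //; apply: lt_le_trans xe _; rewrite lerD2l ge_min lexx.
  have xe2 : rnorm (v - x) ^+ 2 - d <= e ^+ 2.
    by rewrite lerBlDl (le_trans (ltW xe)) // lerD2l ge_min lexx orbT.
  (* As [x] almost minimises the distance, [|v - (x + t u)|^2 >= d] for
     all real [t] forces [v - x] to be almost orthogonal to [u]. *)
  have : rdot (v - x) u ^+ 2 <= (rnorm (v - x) ^+ 2 - d) * rnorm u ^+ 2.
    rewrite -sqrrN; apply: quad_disc; first exact: sqr_ge0.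
    move=> t; have := dS _ (SD _ _ Sx (SZ t%:C _ Su)).
    rewrite opprD addrA; move: (v - x) => y.
    rewrite [X in d <= X]rnorm_sqr rdotBl !rdotBr !rdotZl !rdotZr.
    rewrite (rdotC u) -!rnorm_sqr; lra.
  move=> /le_trans /(_ (ler_wpM2r (sqr_ge0 _) xe2)).
  rewrite -exprMn -(@real_normK _ (rdot (v - x) u)) ?num_real //.
  rewrite ler_pXn2r ?nnegrE ?mulr_ge0 ?rnorm_ge0 ?(ltW e0) // => h1.
  rewrite -[v - w](subrKA x) rdotDl (le_trans (ler_normD _ _)) //.
  have := le_trans (rdot_le (x - w) u) (ler_wpM2r (rnorm_ge0 u) xw).
  rewrite addrC; lra.
Qed.

Lemma bounded_rnorm A : bounded_operator A ->
  exists2 M : R, 0 < M & forall x, rnorm (A x) <= M * rnorm x.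
Proof.
move=> [M hM]; exists (`|M| + 1) => [|x]; first by rewrite ltr_wpDl.
have := hM x; rewrite !normC_rnorm -rmorphM lecR => /le_trans; apply.
by rewrite ler_wpM2r ?rnorm_ge0 // (le_trans (ler_norm _)) // lerDl.
Qed.

Lemma rnorm_bounded A (M : R) :
  (forall x, rnorm (A x) <= M * rnorm x) -> bounded_operator A.
Proof. by move=> h; exists M => x; rewrite !normC_rnorm -rmorphM lecR. Qed.

(** An operator bounded below has a closed range by completeness, and the
    range is everything when nothing is orthogonal to it. *)
Lemma bounded_below_invertible A (c : R) : bounded_operator A -> 0 < c ->
  (forall x, c * rnorm x <= rnorm (A x)) ->
  (forall y, (forall x, '[< A x, y >] = 0) -> y = 0) ->
  invertible_operator A.
Proof.
move=> /bounded_rnorm[M M0 AM] c0 Ac Adense.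
have surj y : exists x, A x = y.
  have rsub : subspace (range A).
    split; first by exists 0 => //; rewrite linear0.
      by move=> _ _ [u _ <-] [v _ <-]; exists (u + v) => //; rewrite linearD.
    by move=> a _ [u _ <-]; exists (a *: u) => //; rewrite linearZ.
  have [w Sw yw] := projection rsub y.
  have {Sw yw} Sy : adherent (range A) y.
    suff /eqP : y - w = 0 by rewrite subr_eq0 => /eqP ->.
    by apply: Adense => x; apply: inner0C; apply: yw; exists x.
  have [d d0|d d' x dd' /le_trans|e e0|l Hl] :=
      @complete_family (fun d => [set x | rnorm (A x - y) <= d]).
  - by have [_ [x _ <-] xe] := Sy _ d0; exists x; rewrite /= rnormB.
  - exact.
  - exists (e * c / 2); first by rewrite divr_gt0 ?mulr_gt0.
    move=> x x' /= xd xd'; rewrite -(ler_pM2r c0) mulrC (le_trans (Ac _)) //.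
    rewrite linearB (le_trans (rnorm_tri _ y _)) // (rnormB y); lra.
  - exists l; apply/eqP; rewrite -subr_eq0; apply/eqP/rnorm0_eq0.
    apply: (@small_eq0 _ (M + 1)) => [|e e0]; first by rewrite addr_ge0 ?ltW.
    have [d d0 hd] := Hl _ e0.
    have m0 : 0 < Num.min d e by rewrite lt_min d0.
    have [_ [x _ <-]] := Sy _ m0; rewrite le_min rnormB => /andP[xd xe].
    rewrite ger0_norm ?rnorm_ge0 // (le_trans (rnorm_tri _ (A x) _)) //.
    rewrite mulrDr mulr1 lerD // -linearB (le_trans (AM _)) //.
    by rewrite mulrC ler_wpM2r ?(ltW M0) // rnormB hd.
have [g gK] := choice surj.
have injA x x' : A x = A x' -> x = x'.
  move=> /eqP; rewrite -subr_eq0 -linearB => /eqP Axx.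
  apply/eqP; rewrite -subr_eq0; apply/eqP/rnorm0_eq0.
  have := Ac (x - x'); rewrite Axx rnorm0 pmulr_rle0 // => h.
  by apply/eqP; rewrite eq_le h rnorm_ge0.
have glin : linear g.
  by move=> a x y; apply: injA; rewrite linearP !gK.
pose G : {linear H -> H} := HB.pack g (GRing.isLinear.Build _ _ _ _ g glin).
exists G; split => //; last first.
- by move=> x; apply: injA; rewrite gK.
- apply: (@rnorm_bounded _ c^-1) => x.
  by rewrite ler_pdivlMl // (le_trans (Ac _)) //= gK.
Qed.

End Completeness.

(** * Uniform boundedness and ranges of finite codimension *)

Section UniformBoundedness.
Context {R : realType} {H : hilbertType R}.
Implicit Types (x y z v w : H) (t : R) (A : {linear H -> H}).

(** One step of the Baire category argument: inside any ball there is a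
    smaller one on which some member of the unbounded family exceeds [N].
    Moving the centre by [r / 2] in the direction of [y] is enough when [y] is
    long. *)
Lemma gliding_hump (Y : set H) :
  (forall M : R, exists2 y, Y y & M < rnorm y) ->
  forall x (r N : R), 0 < r -> 0 <= N -> exists x' r' y,
    [/\ Y y, 0 < r', r' <= (N + 1)^-1, rnorm (x' - x) + r' <= r
      & forall z, rnorm (z - x') <= r' -> N <= `|rdot y z|].
Proof.
move=> Yunb x r N r0 N0.
have [y Yy ybig] := Yunb (4 * (N + 1) / r).
have y0 : 0 < rnorm y by apply: lt_trans ybig; rewrite divr_gt0 //; lra.
have [x' xx' x'N] : exists2 x', rnorm (x' - x) <= r / 2 & N + 1 <= `|rdot y x'|.
  have [h|h] := leP (N + 1) `|rdot y x|.
    by exists x => //; rewrite subrr rnorm0; lra.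
  exists (x + (r / 2 / rnorm y)%:C *: y).
    rewrite addrC addKr rnormZ ger0_norm ?divfK ?gt_eqF //.
    by rewrite !divr_ge0 ?(ltW r0) ?(ltW y0).
  rewrite rdotDr rdotZr -rnorm_sqr.
  have -> : r / 2 / rnorm y * rnorm y ^+ 2 = rnorm y * r / 2.
    by field; rewrite gt_eqF.
  move: ybig; rewrite ltr_pdivrMr // => ybig.
  rewrite ler_normr; apply/orP; left.
  by have := ler_norm (- rdot y x); rewrite normrN; lra.
exists x', (Num.min (r / 2) (Num.min (N + 1)^-1 (rnorm y)^-1)), y; split => //.
- by rewrite !lt_min !invr_gt0 y0 divr_gt0 //=; lra.
- by rewrite !ge_min lexx orbT.
- have : Num.min (r / 2) (Num.min (N + 1)^-1 (rnorm y)^-1) <= r / 2.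
    by rewrite ge_min lexx.
  lra.
- move=> z zx.
  have {}zx : rnorm (z - x') <= (rnorm y)^-1.
    by apply: le_trans zx _; rewrite !ge_min lexx !orbT.
  have : `|rdot y (z - x')| <= 1.
    rewrite (le_trans (rdot_le _ _)) // (le_trans (ler_wpM2l (ltW y0) zx)) //.
    by rewrite divff ?gt_eqF.
  rewrite rdotBr distrC; have := lerB_dist (rdot y x') (rdot y z); lra.
Qed.

(** If the family were unbounded, nested balls given by [gliding_hump]
    would shrink to a point at which it is not weakly bounded. *)
Theorem uniform_boundedness (Y : set H) :
  (forall w, exists M : R, forall y, Y y -> `|rdot y w| <= M) ->
  exists M : R, forall y, Y y -> rnorm y <= M.
Proof.
move=> Yw; apply: contrapT => /forallNP Yunb.
have {}Yunb (M : R) : exists2 y, Y y & M < rnorm y.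
  have /existsNP[y /not_implyP[Yy /negP]] := Yunb M.
  by rewrite -ltNge; exists y.
have hump (s : H * R * nat) : exists s' : H * R, 0 < s.1.2 ->
    [/\ 0 < s'.2, s'.2 <= s.2.+1%:R^-1, rnorm (s'.1 - s.1.1) + s'.2 <= s.1.2
      & exists2 y, Y y & forall z, rnorm (z - s'.1) <= s'.2 -> s.2%:R <= `|rdot y z|].
  case: s => -[x r] n /=; have [r0|r0] := ltP 0 r; last first.
    by exists (x, r) => /=; rewrite ltNge r0.
  have [x' [r' [y [Yy r'0 r'n xx' hy]]]] :=
    gliding_hump Yunb x r0 (ler0n R n).
  exists (x', r') => _; split => //=; last by exists y.
  by rewrite -natr1.
have [f fP] := choice hump.
pose s := fix s n := if n is n'.+1 then f (s n', n') else (0 : H, 1 : R).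
have s0 n : 0 < (s n).2.
  by elim: n => [|n IH] //=; have [] := fP (s n, n) IH.
have nested n z :
    rnorm (z - (s n.+1).1) <= (s n.+1).2 -> rnorm (z - (s n).1) <= (s n).2.
  move=> h; have [_ _ h' _] := fP (s n, n) (s0 n).
  apply: le_trans (rnorm_tri _ (s n.+1).1 _) _; apply: le_trans h'.
  by rewrite addrC lerD2l.
have nest n m z : (n <= m)%N ->
    rnorm (z - (s m).1) <= (s m).2 -> rnorm (z - (s n).1) <= (s n).2.
  by move=> /subnK <-; elim: (m - n)%N => // k IH /nested.
pose F := [set P | exists n, [set z | rnorm (z - (s n).1) <= (s n).2] `<=` P].
have FF : ProperFilter F.
  split=> [[n h]|].
    by have /= := h (s n).1; rewrite subrr rnorm0; apply; exact: ltW.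
  split.
  - by exists 0%N.
  - move=> P Q [n nP] [m mQ]; exists (maxn n m) => z hz; split.
      by apply: nP; apply: nest hz; exact: leq_maxl.
    by apply: mQ; apply: nest hz; exact: leq_maxr.
  - by move=> P Q PQ [n nP]; exists n => z /nP /PQ.
have inv0 (e : R) : 0 < e -> exists n, (s n).2 <= e.
  move=> e0; have [n _ hn] := near_infty_natSinv_lt (PosNum e0).
  exists n.+1; have [_ h _ _] := fP (s n, n) (s0 n).
  by apply: le_trans h _; apply/ltW/hn => /=.
have [e e0|l Fl] := complete_filter FF.
  have [n ne] := inv0 (e / 2) (divr_gt0 e0 (ltr0Sn _ 1)).
  exists [set z | rnorm (z - (s n).1) <= (s n).2]; first by exists n.
  move=> x y /= hx hy; rewrite (le_trans (rnorm_tri _ (s n).1 _)) //.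
  rewrite (rnormB _ y); lra.
have lball n : rnorm (l - (s n).1) <= (s n).2.
  apply/ler_addgt0Pr => e e0.
  have : F [set z | rnorm (z - (s n).1) <= (s n).2] by exists n.
  move=> /(filterI (Fl _ e0)) /filter_ex[z [/= zl zn]].
  rewrite (le_trans (rnorm_tri _ z _)) // rnormB; lra.
have [M hM] := Yw l.
pose n := Num.bound `|M|.
have [_ _ _ [y Yy /(_ l (lball n.+1)) h]] := fP (s n, n) (s0 n).
have := le_trans h (hM _ Yy); rewrite leNgt => /negP; apply.
rewrite /=; apply: le_lt_trans (ler_norm _) _.
by rewrite archi_boundP // ?normr_ge0.
Qed.

End UniformBoundedness.

Section FredholmEstimate.
Context {R : realType} {H : hilbertType R}.
Implicit Types (x y z v w : H) (t : R) (A : {linear H -> H}) (V : seq H).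

(** A real quantity equivalent to the modulus of the complex inner product,
    which avoids square roots. *)
Definition l1dot x y : R := `|rdot x y| + `|rdot x ('i *: y)|.

Definition l1seq V x : R := \sum_(v <- V) l1dot x v.

Lemma l1dot_ge0 x y : 0 <= l1dot x y.
Proof. by rewrite addr_ge0. Qed.

Lemma l1seq_ge0 V x : 0 <= l1seq V x.
Proof. by apply: sumr_ge0 => v _; exact: l1dot_ge0. Qed.

Lemma l1seq_eq0 V x : (forall v, v \in V -> '[< x, v >] = 0) -> l1seq V x = 0.
Proof.
move=> h; rewrite /l1seq big_seq big1 // => v /h; rewrite inner_rdot.
by case=> xv xiv; rewrite /l1dot xv xiv normr0 addr0.
Qed.

Lemma l1dotZ t x y : l1dot (t%:C *: x) y = `|t| * l1dot x y.
Proof. by rewrite /l1dot !rdotZl !normrM mulrDr. Qed.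

Lemma l1seqZ t V x : l1seq V (t%:C *: x) = `|t| * l1seq V x.
Proof. by rewrite /l1seq mulr_sumr; apply: eq_bigr => v _; rewrite l1dotZ. Qed.

Lemma rdotZc x (c : R[i]) y :
  rdot x (c *: y) = complex.Re c * rdot x y + complex.Im c * rdot x ('i *: y).
Proof.
rewrite {1}[c]complexE scalerDl rdotDr rdotZr.
by rewrite (mulrC 'i) -scalerA rdotZr.
Qed.

Lemma rdotZc_le x (c : R[i]) y :
  `|rdot x (c *: y)| <= (`|complex.Re c| + `|complex.Im c|) * l1dot x y.
Proof.
rewrite rdotZc (le_trans (ler_normD _ _)) // !normrM /l1dot.
have := normr_ge0 (complex.Re c); have := normr_ge0 (complex.Im c).
have := normr_ge0 (rdot x y); have := normr_ge0 (rdot x ('i *: y)).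
nra.
Qed.

(** Write any [w] as [A z + sum_i c_i v_i]. Then
    [<y, w> = <A y, z> + sum_i <y, c_i v_i>] is bounded over all [y] for which
    [A y] and the [<y, v_i>] are bounded by 1, so the uniform boundedness
    principle bounds these [y]. This replaces the closed range theorem: no
    closedness of the range has to be known beforehand. *)
Lemma cofinite_range_estimate A : selfadjoint A ->
  finite_dim_quotient setT (range A) ->
  exists C V, 0 < C /\ forall y, rnorm y <= C * (rnorm (A y) + l1seq V y).
Proof.
move=> Aself [n [v [_ hv]]].
pose V := [seq v i | i <- enum 'I_n].
pose Y := [set y | rnorm (A y) + l1seq V y <= 1].
have [w|M YM] := @uniform_boundedness _ _ Y.
  have [c [z _ Az]] := hv w I.
  exists (rnorm z + \sum_i (`|complex.Re (c i)| + `|complex.Im (c i)|)) => y Yy.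
  have -> : w = A z + \sum_i c i *: v i by rewrite Az subrK.
  have rA : rdot y (A z) = rdot (A y) z by rewrite /rdot Aself.
  have Ay1 : rnorm (A y) <= 1.
    by apply: le_trans Yy; rewrite lerDl l1seq_ge0.
  rewrite rdotDr (le_trans (ler_normD _ _)) // lerD // ?rA.
    by rewrite (le_trans (rdot_le _ _)) // ler_piMl ?rnorm_ge0.
  rewrite rdot_sumr (le_trans (ler_norm_sum _ _ _)) // ler_sum // => i _.
  rewrite (le_trans (rdotZc_le _ _ _)) // ler_piMr ?addr_ge0 //.
  have : l1seq V y <= 1 by apply: le_trans Yy; rewrite lerDr rnorm_ge0.
  apply: le_trans; rewrite /l1seq /V big_map big_enum /= (bigD1 i) //= lerDl.
  by apply: sumr_ge0 => j _; exact: l1dot_ge0.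
exists (`|M| + 1), V; split => [|y]; first by rewrite ltr_wpDl.
set s := _ + l1seq V y.
have s0 : 0 <= s by rewrite addr_ge0 ?rnorm_ge0 ?l1seq_ge0.
(* Rescaling by [s + d] instead of [s] covers the case [s = 0]. *)
apply/ler_addgt0Pr => e e0; pose d := e / (`|M| + 1).
have M1 : 0 < `|M| + 1 by rewrite ltr_wpDl.
have d0 : 0 < d by rewrite divr_gt0.
have sd0 : 0 < s + d by rewrite ltr_wpDl.
have := YM (((s + d)^-1)%:C *: y).
rewrite /Y /= linearZ /= l1seqZ !rnormZ -mulrDr -/s ger0_norm ?invr_ge0 ?(ltW sd0) //.
rewrite ler_pdivrMl // mulr1 lerDl (ltW d0) => /(_ isT).
rewrite ler_pdivrMl // => /le_trans; apply.
have -> : (`|M| + 1) * s + e = (s + d) * (`|M| + 1).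
  by rewrite [RHS]mulrDl divfK ?gt_eqF // mulrC.
by rewrite ler_wpM2l ?(ltW sd0) // (le_trans (ler_norm _)) // lerDl.
Qed.

End FredholmEstimate.

(** * Essential lower bounds of a quadratic form *)

Section EssentialLowerBound.
Context {R : realType} {H : hilbertType R}.
Implicit Types (x y z v w : H) (t m e : R) (A T : {linear H -> H}) (V : seq H).

Definition orth (S : set H) : set H := [set x | forall v, S v -> '[< x, v >] = 0].

Lemma orth_subspace (S : set H) : subspace (orth S).
Proof.
split=> [v _|x y xS yS v Sv|c x xS v Sv]; first by rewrite linear0l.
  by rewrite linearDl /= xS ?yS ?addr0.
by rewrite linearZl_LR /= xS ?mulr0.
Qed.

Definition shift T (l : R[i]) : {linear H -> H} := T \- l \*: idfun.

Lemma shiftE T l x : shift T l x = T x - l *: x.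
Proof. by []. Qed.

Lemma shift_selfadjoint T m : selfadjoint T -> selfadjoint (shift T m%:C).
Proof.
move=> Tself x y; rewrite !shiftE linearBl linearBr /= Tself.
by rewrite linearZl_LR linearZr_LR /= conj_Creal ?complex_real.
Qed.

Lemma rdot_shift T m x :
  rdot (shift T m%:C x) x = rdot (T x) x - m * rnorm x ^+ 2.
Proof. by rewrite shiftE rdotBl rdotZl rnorm_sqr. Qed.

Lemma shift_rnorm T m M : (forall x, rnorm (T x) <= M * rnorm x) ->
  forall x, rnorm (shift T m%:C x) <= (M + `|m|) * rnorm x.
Proof.
move=> TM x; rewrite shiftE (le_trans (rnormD _ _)) // rnormN rnormZ mulrDl.
by rewrite lerD2r.
Qed.

(** Cauchy-Schwarz for the form [<A x, y>], nonnegative on [S], applied to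
    [x] and [A x]:
    [|Ax|^4 <= <Ax, x> <A Ax, Ax> <= <Ax, x> M |Ax|^2]. *)
Lemma psd_rnorm_le A M (S : set H) : selfadjoint A ->
  0 <= M ->
  (forall x, rnorm (A x) <= M * rnorm x) -> subspace S ->
  (forall z, S z -> 0 <= rdot (A z) z) ->
  forall x, S x -> S (A x) -> rnorm (A x) ^+ 2 <= M * rdot (A x) x.
Proof.
move=> Aself M0 AM [S0 SD SZ] Apos x Sx SAx.
have sym y z : rdot (A y) z = rdot y (A z) by rewrite /rdot Aself.
have a0 := Apos _ Sx; have c0 := Apos _ SAx.
have : rdot (A x) (A x) ^+ 2 <= rdot (A x) x * rdot (A (A x)) (A x).
  apply: quad_disc => // t; have := Apos _ (SD _ _ Sx (SZ t%:C _ SAx)).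
  rewrite linearD linearZ /= rdotDl !rdotDr !rdotZl !rdotZr (sym (A x) x).
  lra.
have : rdot (A (A x)) (A x) <= M * rnorm (A x) ^+ 2.
  rewrite (le_trans (ler_norm _)) // (le_trans (rdot_le _ _)) //.
  by rewrite expr2 mulrA ler_wpM2r ?rnorm_ge0.
rewrite -rnorm_sqr.
have := sqr_ge0 (rnorm (A x)); rewrite le_eqVlt => /predU1P[<- _ _|].
  by rewrite mulr_ge0.
set b := rnorm (A x) ^+ 2 => b0 cb bac.
rewrite -(ler_pM2r b0) -expr2 (le_trans bac) // mulrAC mulrC ler_wpM2r //.
Qed.

Definition ess_bounded_below T m :=
  exists F : seq H, forall x, orth [set` F] x -> m * rnorm x ^+ 2 <= rdot (T x) x.

Lemma ess_positive_estimate T : essentially_positive T -> forall m, m < 0 ->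
  exists C V, 0 < C /\
    forall y, rnorm y <= C * (rnorm (T y - m%:C *: y) + l1seq V y).
Proof.
move=> [Tself Tess] m m0.
have [_ ran] : fredholm (T \- m%:C \*: idfun).
  by apply: contrapT => /Tess /=; rewrite ler0c leNgt m0.
by have := cofinite_range_estimate (shift_selfadjoint m Tself) ran.
Qed.

(** The supremum [m] of the essential lower bounds is not negative:
    otherwise [T - m] would be Fredholm, whereas vectors orthogonal to a large
    finite set on which the form is close to [m] are almost in its kernel. *)
Lemma ess_positive_bounded_below T : bounded_operator T -> essentially_positive T ->
  forall e, 0 < e -> ess_bounded_below T (- e).
Proof.
move=> /bounded_rnorm[M M0 TM] Tess e e0; apply: contrapT => nGe.
pose G := [set mu | ess_bounded_below T mu].
have Gle mu : G mu -> mu < - e.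
  move=> [F hF]; rewrite ltNge; apply/negP => emu; apply: nGe.
  by exists F => x /hF; apply: le_trans; rewrite ler_wpM2r ?sqr_ge0.
have Gsup : has_sup G.
  split; last by exists (- e) => mu /Gle /ltW.
  exists (- M); exists [::] => x _.
  rewrite mulNr lerNl -rdotNl (le_trans (ler_norm _)) //.
  rewrite (le_trans (rdot_le _ _)) // rnormN expr2 mulrA.
  by rewrite ler_wpM2r ?rnorm_ge0.
pose m := sup G.
have m0 : m < 0.
  apply: (@le_lt_trans _ _ (- e)); last by rewrite oppr_lt0.
  by apply: ge_sup; [case: Gsup|move=> mu /Gle /ltW].
have [C [V [C0 CV]]] := ess_positive_estimate Tess m0.
have Tself : selfadjoint T by case: Tess.
pose M' := M + `|m| + 1; have M'0 : 0 < M'.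
  by rewrite /M'; have := normr_ge0 m; lra.
(* The final estimate reads [|x|^2 <= k d |x|^2], so that [d] is chosen
   with [k d < 1] and [d <= 1]. *)
pose k := C ^+ 2 * (4 * M' + 2).
have k0 : 0 < k by rewrite mulr_gt0 ?exprn_gt0 //; lra.
pose d := (k + 1)^-1.
have d0 : 0 < d by rewrite invr_gt0; lra.
have d1 : d <= 1 by rewrite invf_le1 ?lerDr; lra.
have kd : k * d < 1 by rewrite ltr_pdivrMr; lra.
have [mu [F hF] mmu] := sup_adherent d0 Gsup.
have nG : ~ G (m + d).
  by move=> /(sup_upper_bound Gsup); rewrite -/m gerDl leNgt d0.
(* Orthogonality to [F] makes the shifted form nonnegative at [x],
   orthogonality to [T F] keeps [T x] orthogonal to [F], and orthogonality to
   [V] kills the last term of the Fredholm estimate. *)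
have [x [xF xd]] : exists x, orth [set` F ++ [seq T v | v <- F] ++ V] x
    /\ rdot (T x) x < (m + d) * rnorm x ^+ 2.
  apply: contrapT => /forallNP h; apply: nG.
  exists (F ++ [seq T v | v <- F] ++ V) => x xF; rewrite leNgt.
  by apply/negP => xd; apply: (h x).
have xF1 : orth [set` F] x by move=> v vF; apply: xF; rewrite /= mem_cat vF.
have xV : l1seq V x = 0.
  by apply: l1seq_eq0 => v vV; apply: xF; rewrite /= !mem_cat vV !orbT.
pose A := shift T (m - d)%:C.
have AxF : orth [set` F] (A x).
  move=> v vF; rewrite linearBl /= linearZl_LR /= xF1 // mulr0 subr0 Tself.
  by apply: xF; rewrite /= !mem_cat map_f ?orbT.
have AM z : rnorm (A z) <= M' * rnorm z.
  apply: le_trans (shift_rnorm (m - d) TM z) _; rewrite ler_wpM2r ?rnorm_ge0 //.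
  rewrite /M' -addrA lerD2l (le_trans (ler_normB _ _)) // lerD2l.
  by rewrite gtr0_norm.
have Apos z : orth [set` F] z -> 0 <= rdot (A z) z.
  move=> /hF; rewrite rdot_shift subr_ge0; apply: le_trans.
  by rewrite ler_wpM2r ?sqr_ge0 ?(ltW mmu).
have := psd_rnorm_le (shift_selfadjoint _ Tself) (ltW M'0) AM
  (orth_subspace _) Apos xF1 AxF.
rewrite rdot_shift.
have x2 : 0 < rnorm x ^+ 2.
  rewrite lt_def sqr_ge0 andbT; apply/negP => /eqP x0.
  move: xd; rewrite x0 mulr0; have := hF _ xF1; rewrite x0 mulr0; lra.
have := CV x; rewrite xV addr0.
have -> : T x - m%:C *: x = A x - d%:C *: x.
  by rewrite /A shiftE -addrA -opprD -scalerDl -rmorphD subrK.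
move=> xC Ax2.
have {}xC : rnorm x <= C * (rnorm (A x) + d * rnorm x).
  apply: le_trans xC _; rewrite ler_wpM2l ?(ltW C0) //.
  by rewrite (le_trans (rnormD _ _)) // rnormN rnormZ gtr0_norm.
have {}Ax2 : rnorm (A x) ^+ 2 <= M' * (2 * d) * rnorm x ^+ 2.
  apply: le_trans Ax2 _; rewrite -mulrA ler_wpM2l ?(ltW M'0) //; nra.
have : rnorm x ^+ 2 <= (C * (rnorm (A x) + d * rnorm x)) ^+ 2.
  by rewrite ler_pXn2r ?nnegrE ?rnorm_ge0 // (le_trans (rnorm_ge0 x)).
have sq (a b : R) : (a + b) ^+ 2 <= 2 * a ^+ 2 + 2 * b ^+ 2.
  by have := sqr_ge0 (a - b); lra.
rewrite exprMn => /le_trans /(_ (ler_wpM2l (sqr_ge0 C) (sq _ _))).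
move=> /le_trans h.
have : rnorm x ^+ 2 <= (k * d) * rnorm x ^+ 2.
  have -> : k * d * rnorm x ^+ 2 = C ^+ 2 * ((4 * M' + 2) * d * rnorm x ^+ 2).
    by rewrite /k; ring.
  apply: h; rewrite ler_wpM2l ?sqr_ge0 // exprMn.
  have : d ^+ 2 * rnorm x ^+ 2 <= d * rnorm x ^+ 2.
    by rewrite ler_wpM2r ?(ltW x2) // expr2 ler_piMr ?(ltW d0).
  by move: Ax2; lra.
by rewrite leNgt gtr_pMl // kd.
Qed.

End EssentialLowerBound.

(** * Limits along ultrafilters, compact operators and attained infima *)

Section Ultrafilters.
Context {R : realType} {H : hilbertType R}.
Implicit Types (x y z v w l : H) (t m e C : R) (A T K : {linear H -> H}) (V : seq H).

Lemma ultra_real (X : Type) (U : set_system X) (UU : UltraFilter U)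
    (g : X -> R) (M : R) :
  U [set a | `|g a| <= M] -> forall e, 0 < e ->
  exists2 P, U P & forall a b, P a -> P b -> `|g a - g b| <= e.
Proof.
move=> UM e e0; have UP : ProperFilter U by exact: ultra_proper.
have gU : (g @ U) `[- M, M]%classic.
  by rewrite fmapE; apply: filterS UM => a; rewrite /= in_itv /= -ler_norml.
have [p [_ pU]] := @segment_compact R (- M) M (g @ U) (fmap_proper_filter g UP) gU.
pose B := [set a | `|p - g a| < e / 2].
have [UB|UB] := in_ultra_setVsetC B UU.
  exists B => // x y; rewrite /B /= => xB yB.
  rewrite (le_trans (ler_distD p _ _)) // (distrC (g x)); lra.
suff [z []//] : (~` ball p (e / 2) `&` ball p (e / 2)) !=set0.
apply: pU; last by apply: nbhsx_ballx; rewrite divr_gt0.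
exact: UB.
Qed.

Lemma ultra_l1seq (U : set_system H) (UU : UltraFilter U) (M : R) V :
  U [set x | rnorm x <= M] -> forall e, 0 < e ->
  exists2 P, U P & forall x y, P x -> P y -> l1seq V (x - y) <= e.
Proof.
move=> UM; have UP : ProperFilter U by exact: ultra_proper.
have Urdot v e : 0 < e ->
    exists2 P, U P & forall x y, P x -> P y -> `|rdot (x - y) v| <= e.
  move=> e0.
  have [|P UPP hP] := @ultra_real _ U UU (rdot^~ v) (M * rnorm v) _ _ e0.
    apply: filterS UM => x /= xM.
    by rewrite (le_trans (rdot_le _ _)) // ler_wpM2r ?rnorm_ge0.
  by exists P => // x y Px Py; rewrite rdotBl hP.
elim: V => [|v V IH] e e0.
  by exists setT; [exact: filterT|move=> x y _ _; rewrite /l1seq big_nil ltW].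
have e4 : 0 < e / 4 by rewrite divr_gt0.
have e2 : 0 < e / 2 by rewrite divr_gt0.
have [P UPP hP] := Urdot v _ e4; have [Q UQ hQ] := Urdot ('i *: v) _ e4.
have [S US hS] := IH _ e2.
exists (P `&` Q `&` S); first by do 2?apply: filterI.
move=> x y [[Px Qx] Sx] [[Py Qy] Sy]; rewrite /l1seq big_cons -/(l1seq V _) /l1dot.
have := hP _ _ Px Py; have := hQ _ _ Qx Qy; have := hS _ _ Sx Sy; lra.
Qed.

(** Along an ultrafilter of bounded vectors all inner products with fixed
    vectors converge. A map controlled by finitely many of them, up to an
    arbitrarily small error, thus has a Cauchy image. *)
Lemma ultra_cvg (U : set_system H) (UU : UltraFilter U) (M : R) (g : H -> H) :
  U [set x | rnorm x <= M] ->
  (forall e, 0 < e -> exists P C V, [/\ U P, 0 <= C &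
     forall x y, P x -> P y -> rnorm (g x - g y) <= e + C * l1seq V (x - y)]) ->
  exists l, forall e, 0 < e -> U [set x | rnorm (g x - l) <= e].
Proof.
move=> UM hg; have UP : ProperFilter U by exact: ultra_proper.
have [e e0|l hl] := @complete_filter _ _ (g @ U) (fmap_proper_filter g UP);
  last by exists l.
have e2 : 0 < e / 2 by rewrite divr_gt0.
have [P [C [V [UPP C0 hP]]]] := hg _ e2.
have d0 : 0 < e / 2 / (C + 1) by rewrite divr_gt0 // ltr_wpDl.
have [Q UQ hQ] := ultra_l1seq UU V UM d0.
exists (g @` (P `&` Q)).
  by rewrite fmapE; apply: filterS (filterI UPP UQ) => x PQx; exists x.
move=> _ _ [x [Px Qx] <-] [y [Py Qy] <-].
rewrite (le_trans (hP _ _ Px Py)) //.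
have := hQ _ _ Qx Qy; rewrite ler_pdivlMr ?ltr_wpDl //.
have := l1seq_ge0 V (x - y); lra.
Qed.

Lemma nbhs_rnorm x (B : set H) :
  nbhs x B <-> exists2 e, 0 < e & forall y, rnorm (y - x) <= e -> B y.
Proof.
split=> [/nbhs_ballP[e /= e0 hB]|[e e0 hB]].
  have e1 : e = (complex.Re e)%:C by rewrite RRe_real // gtr0_real.
  have {}e0 : 0 < complex.Re e by rewrite -ltcR -e1.
  exists (complex.Re e / 2); first by rewrite divr_gt0.
  move=> y xy; apply: hB; rewrite -ball_normE /= normC_rnorm e1 ltcR rnormB.
  by apply: le_lt_trans xy _; lra.
apply/nbhs_ballP; exists e%:C; first by rewrite /= ltcR.
move=> y; rewrite -ball_normE /= normC_rnorm ltcR rnormB => /ltW; exact: hB.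
Qed.

Definition unit_ball : set H := [set x | `|x| <= 1].

Lemma unit_ballE x : unit_ball x = (rnorm x <= 1) :> Prop.
Proof. by rewrite /unit_ball /= normC_rnorm -[1]/(1%:C) lecR. Qed.

(** Given a filter [F] on the closure of the image of the unit ball, the
    points of the ball that are mapped close to the members of [F] generate a
    filter; along an ultrafilter refining it [K] converges, by [ultra_cvg], to
    a cluster point of [F]. *)
Lemma compact_operator_l1seq K : bounded_operator K ->
  (forall e, 0 < e -> exists C V, 0 <= C /\
     forall x, rnorm (K x) <= e * rnorm x + C * l1seq V x) ->
  compact_operator K.
Proof.
move=> Kb hK; split=> //; rewrite precompactE => F FF Fcl.
pose near P e := [set x | rnorm x <= 1 /\ exists2 p, P p & rnorm (K x - p) <= e].
pose G := [set Q | exists P e, [/\ F P, 0 < e & near P e `<=` Q]].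
have GF : ProperFilter G.
  split=> [[P [e [FP e0 hP]]]|].
    have [p [Pp /(_ [set y | rnorm (y - p) <= e])]] := filter_ex (filterI FP Fcl).
    case; first by apply/nbhs_rnorm; exists e.
    move=> _ [[x x1 <-] /= xp]; apply: (hP x); split; first by rewrite -unit_ballE.
    by exists p.
  split.
  - by exists setT, 1; split=> //; exact: filterT.
  - move=> P Q [P' [e [FP e0 hP]]] [Q' [e' [FQ e'0 hQ]]].
    exists (P' `&` Q'), (Num.min e e'); split; first exact: filterI.
      by rewrite lt_min e0.
    move=> x [x1 [p [P'p Q'p]]]; rewrite le_min => /andP[xe xe'].
    by split; [apply: hP|apply: hQ]; split=> //; exists p.
  - by move=> P Q PQ [P' [e [FP e0 hP]]]; exists P', e; split=> // x /hP /PQ.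
have [U [UU GU]] := ultraFilterLemma GF.
have UP : ProperFilter U by exact: ultra_proper.
have U1 : U [set x | rnorm x <= 1].
  by apply: GU; exists setT, 1; split=> //; [exact: filterT|move=> x []].
have [e e0|l hl] := @ultra_cvg U UU 1 K U1.
  have e2 : 0 < e / 2 by rewrite divr_gt0.
  have [C [V [C0 hC]]] := hK _ e2.
  exists [set x | rnorm x <= 1], C, V; split=> // x y /= x1 y1.
  rewrite -linearB (le_trans (hC _)) // lerD2r.
  have := rnormD x (- y); rewrite rnormN => xy.
  have : e / 2 * rnorm (x - y) <= e / 2 * 2.
    by apply: ler_wpM2l; [exact: ltW|lra].
  lra.
have UK e : 0 < e -> U [set x | rnorm x <= 1 /\ rnorm (K x - l) <= e].
  by move=> e0; apply: filterS (filterI U1 (hl _ e0)).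
exists l; split.
  move=> B /nbhs_rnorm[e e0 hB].
  have [x [x1 xl]] := filter_ex (UK _ e0).
  exists (K x); split; last exact: hB.
  by exists x => //; rewrite -/(unit_ball x) unit_ballE.
move=> P B FP /nbhs_rnorm[e e0 hB].
have e2 : 0 < e / 2 by rewrite divr_gt0.
have UN : U (near P (e / 2)) by apply: GU; exists P, (e / 2); split.
have [x [[x1 xl] [_ [p Pp xp]]]] := filter_ex (filterI (UK _ e2) UN).
exists p; split=> //; apply: hB; rewrite (le_trans (rnorm_tri _ (K x) _)) //.
rewrite rnormB; lra.
Qed.

Lemma compact_operator_net K : compact_operator K -> forall e, 0 < e ->
  exists Y : seq H, forall x, rnorm x <= 1 ->
    exists2 y, y \in Y & rnorm (K x - y) < e.
Proof.
move=> [_]; rewrite precompactE compact_cover => cK e e0.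
have [y _|x _|Y _ hY] := cK H setT (fun y => ball y e%:C).
- exact: ball_open.
- by exists x => //; apply: ballxx; rewrite ltcR.
- exists (finmap.enum_fset Y) => x x1.
  have [|y Yy] := hY (K x).
    by apply: subset_closure; exists x => //; rewrite -/(unit_ball x) unit_ballE.
  by rewrite -ball_normE /= normC_rnorm ltcR rnormB; exists y.
Qed.

(** A minimising ultrafilter [U] of unit vectors of [N] satisfies
    [(T - m) x -> 0] by [psd_rnorm_le]. The estimate bounds [|x - y|] by
    [(T - m) (x - y)] and finitely many inner products, so [U] converges,
    and its limit is an eigenvector. *)
Lemma attained_on_subspace T (N : set H) m : bounded_operator T ->
  selfadjoint T -> subspace N -> (forall x, adherent N x -> N x) ->
  (forall x, N x -> N (T x)) ->
  (exists C V, 0 < C /\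
    forall y, rnorm y <= C * (rnorm (shift T m%:C y) + l1seq V y)) ->
  (forall x, N x -> m * rnorm x ^+ 2 <= rdot (T x) x) ->
  (forall e, 0 < e -> exists x, [/\ N x, rnorm x = 1 & rdot (T x) x < m + e]) ->
  exists x, [/\ N x, rnorm x = 1 & T x = m%:C *: x].
Proof.
move=> /bounded_rnorm[M M0 TM] Tself Nsub Ncl NT [C [V [C0 hC]]] Tm hm.
have [N0 ND NZ] := Nsub.
have AM := shift_rnorm m TM; set A := shift T m%:C in hC AM.
have M'0 : 0 <= M + `|m| by rewrite addr_ge0 // ltW.
pose S e := [set x | [/\ N x, rnorm x = 1 & rdot (T x) x < m + e]].
pose F := [set P | exists2 e, 0 < e & S e `<=` P].
have FF : ProperFilter F.
  split=> [[e e0 hS]|]; first by have [x Sx] := hm _ e0; exact: hS Sx.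
  split.
  - by exists 1.
  - move=> P Q [e e0 hP] [e' e'0 hQ]; exists (Num.min e e'); first by rewrite lt_min e0.
    by move=> x [Nx x1 xe]; split; [apply: hP|apply: hQ]; split=> //;
      apply: lt_le_trans xe _; rewrite lerD2l ge_min lexx ?orbT.
  - by move=> P Q PQ [e e0 hP]; exists e => // x /hP /PQ.
have [U [UU FU]] := ultraFilterLemma FF.
have UP : ProperFilter U by exact: ultra_proper.
have NA x : N x -> N (A x).
  move=> Nx; rewrite /A shiftE -scaleN1r scalerA.
  by apply: ND; [exact: NT|exact: NZ].
have UA e : 0 < e -> U [set x | [/\ N x, rnorm x = 1 & rnorm (A x) <= e]].
  move=> e0; apply: FU; exists (e ^+ 2 / (M + `|m|)).
    by rewrite divr_gt0 ?exprn_gt0 // ltr_wpDr.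
  move=> x [Nx x1 xe]; split=> //.
  rewrite -(ler_pXn2r (n := 2)) ?nnegrE ?rnorm_ge0 ?(ltW e0) //.
  have Apos z : N z -> 0 <= rdot (A z) z by move=> /Tm; rewrite rdot_shift subr_ge0.
  apply: le_trans (psd_rnorm_le (shift_selfadjoint m Tself) M'0 AM Nsub Apos
    Nx (NA _ Nx)) _.
  rewrite rdot_shift x1 expr1n mulr1 mulrC -ler_pdivlMr ?ltr_wpDr //.
  by rewrite lerBlDl ltW.
have [|e e0|l hl] := @ultra_cvg U UU 1 id _.
- by apply: filterS (UA _ ltr01) => x [_ x1 _]; rewrite /= x1.
- have d0 : 0 < e / (2 * C) by rewrite divr_gt0 ?mulr_gt0.
  exists [set x | [/\ N x, rnorm x = 1 & rnorm (A x) <= e / (2 * C)]], C, V.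
  split; [exact: (UA _ d0)|exact: ltW|].
  move=> x y [_ _ xe] [_ _ ye]; rewrite (le_trans (hC _)) // mulrDr lerD2r.
  rewrite linearB; have := rnormD (A x) (- A y); rewrite rnormN => h.
  have {h} : rnorm (A x - A y) <= e / (2 * C) * 2 by lra.
  move=> /(ler_wpM2l (ltW C0)) /le_trans; apply.
  by rewrite le_eqVlt; apply/orP; left; apply/eqP; field; rewrite gt_eqF.
have lU e : 0 < e ->
    exists x, [/\ N x, rnorm x = 1, rnorm (A x) <= e & rnorm (x - l) <= e].
  move=> e0; have [x [[Nx x1 xA] xl]] := filter_ex (filterI (UA _ e0) (hl _ e0)).
  by exists x.
exists l; split.
- apply: Ncl => e e0; have [x [Nx _ _ xl]] := lU _ e0.
  by exists x => //; rewrite rnormB.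
- apply/eqP; rewrite -subr_eq0; apply/eqP.
  apply: (@small_eq0 _ _ 1) => // e e0; have [x [Nx x1 _ xl]] := lU _ e0.
  rewrite mulr1 -x1 ler_norml; apply/andP; split.
    have := rnorm_tri x l 0; rewrite !subr0; lra.
  have := rnorm_tri l x 0; rewrite !subr0 (rnormB l); lra.
- apply/eqP; rewrite -subr_eq0; apply/eqP/rnorm0_eq0.
  rewrite -[_ - _]/(A l); apply: (@small_eq0 _ _ (M + `|m| + 1)); first by lra.
  move=> e e0; have [x [_ _ xA xl]] := lU _ e0.
  rewrite ger0_norm ?rnorm_ge0 // -[A l](subrK (A x)) -linearB.
  rewrite (le_trans (rnormD _ _)) // mulrDr mulr1 lerD // (le_trans (AM _)) //.
  by rewrite mulrC ler_wpM2r // rnormB.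
Qed.

End Ultrafilters.

(** * Projectors and eigenvectors with negative eigenvalue *)

Section Projectors.
Context {R : realType} {H : hilbertType R}.
Implicit Types (x y z v w : H) (t m e C : R) (A T K P : {linear H -> H}).
Implicit Types (S : set H).

Lemma adherent_sub S x : S x -> adherent S x.
Proof. by move=> Sx e e0; exists x => //; rewrite subrr rnorm0 ltW. Qed.

Lemma adherent_subspace S : subspace S -> subspace (adherent S).
Proof.
move=> [S0 SD SZ]; split=> [|x y Sx Sy e e0|c x Sx e e0].
- exact: adherent_sub.
- have e2 : 0 < e / 2 by rewrite divr_gt0.
  have [u Su xu] := Sx _ e2; have [v Sv yv] := Sy _ e2.
  exists (u + v); first exact: SD.
  rewrite opprD addrACA (le_trans (rnormD _ _)) //; lra.
- pose k := `|complex.Re c| + `|complex.Im c|.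
  have k0 : 0 <= k by rewrite addr_ge0.
  have d0 : 0 < e / (k + 1) by rewrite divr_gt0 // ltr_wpDl.
  have [u Su xu] := Sx _ d0; exists (c *: u); first exact: SZ.
  rewrite -scalerBr (le_trans (rnorm_scale_le _ _)) // -/k.
  move: xu; rewrite ler_pdivlMr ?ltr_wpDl //; have := rnorm_ge0 (x - u); lra.
Qed.

Lemma orth_adherent S : orth (adherent S) = orth S.
Proof.
apply/seteqP; split=> x xS v Sv; first by apply: xS; exact: adherent_sub.
have rd (c : R[i]) : rdot x (c *: v) = 0.
  pose k := `|complex.Re c| + `|complex.Im c|.
  have k0 : 0 <= k by rewrite addr_ge0.
  apply: (@small_eq0 _ _ (k * rnorm x)); first by rewrite mulr_ge0 ?rnorm_ge0.
  move=> e e0; have [u Su vu] := Sv _ e0.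
  have xu : rdot x (c *: u) = 0.
    by apply: rdot_inner0; rewrite linearZr_LR /= xS // mulr0.
  rewrite -[v](subrK u) scalerDr rdotDr xu addr0 (le_trans (rdot_le _ _)) //.
  rewrite mulrA (mulrC _ (rnorm x)) ler_wpM2l ?rnorm_ge0 //.
  by rewrite (le_trans (rnorm_scale_le _ _)) // mulrC ler_wpM2r.
by rewrite inner_rdot rd -[v]scale1r rd.
Qed.

Lemma orth_closed S x : adherent (orth S) x -> orth S x.
Proof.
move=> Sx v Sv; apply: inner0C.
have : orth (adherent (orth S)) v.
  by rewrite orth_adherent => u Su; apply: inner0C; exact: Su.
exact.
Qed.

Lemma orth_invariant T S : selfadjoint T -> (forall x, S x -> S (T x)) ->
  forall x, orth S x -> orth S (T x).
Proof. by move=> Tself ST x xS v /ST Sv; rewrite Tself xS. Qed.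

Lemma adherent_invariant T S : bounded_operator T -> (forall x, S x -> S (T x)) ->
  forall x, adherent S x -> adherent S (T x).
Proof.
move=> /bounded_rnorm[M M0 TM] ST x Sx e e0.
have [u Su xu] := Sx _ (divr_gt0 e0 M0); exists (T u); first exact: ST.
by rewrite -linearB (le_trans (TM _)) // mulrC -ler_pdivlMr.
Qed.

Lemma rnorm_pythagoras x y : '[< x, y >] = 0 ->
  rnorm (x + y) ^+ 2 = rnorm x ^+ 2 + rnorm y ^+ 2.
Proof.
move=> /rdot_inner0 xy; rewrite !rnorm_sqr rdotDl !rdotDr (rdotC y x) xy.
lra.
Qed.

(** The foot of the perpendicular is unique, since only 0 is both adherent
    and orthogonal to [S]; uniqueness gives linearity. *)
Lemma orth_projector S : subspace S -> exists P,
  [/\ selfadjoint P, forall x, adherent S (P x), forall x, orth S (x - P x)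
    & forall x, rnorm (P x) <= rnorm x].
Proof.
move=> Ssub; have [A0 AD AZ] := adherent_subspace Ssub.
have [_ orthD orthZ] := orth_subspace S.
have proj v : exists w, adherent S w /\ orth S (v - w).
  by have [w] := projection Ssub v; exists w.
have [p pP] := choice proj.
have uniq z : adherent S z -> orth S z -> z = 0.
  move=> Sz; rewrite -orth_adherent => /(_ _ Sz) /rdot_inner0.
  by rewrite -rnorm_sqr => /eqP; rewrite sqrf_eq0 => /eqP /rnorm0_eq0.
have plin : linear p.
  move=> a x y; apply/eqP; rewrite -subr_eq0; apply/eqP; apply: uniq.
    rewrite -scaleN1r; apply/AD; first by case: (pP (a *: x + y)).
    by apply/AZ/AD; [apply/AZ|]; case: (pP x); case: (pP y).
  have -> : p (a *: x + y) - (a *: p x + p y) =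
      (a *: (x - p x) + (y - p y)) + -1 *: ((a *: x + y) - p (a *: x + y)).
    by rewrite scaleN1r opprB scalerBr (addrACA (a *: x)) -opprD [RHS]addrC subrKA.
  apply/orthD; first by apply/orthD; [apply/orthZ|]; case: (pP x); case: (pP y).
  by apply: orthZ; case: (pP (a *: x + y)).
pose P : {linear H -> H} := HB.pack p (GRing.isLinear.Build _ _ _ _ p plin).
have orthP x y : '[< x - P x, P y >] = 0.
  have [_] := pP x; rewrite -orth_adherent; apply.
  by case: (pP y).
exists P; split=> [x y|x|x|x]; first last.
- rewrite -(ler_pXn2r (n := 2)) ?nnegrE ?rnorm_ge0 //.
  by rewrite -{2}(subrK (P x) x) rnorm_pythagoras // lerDr sqr_ge0.
- by case: (pP x).
- by case: (pP x).
- rewrite -{2}(subrK (P x) x) -{1}(subrK (P y) y) linearDl linearDr /=.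
  by rewrite orthP (inner0C (orthP y x)) !add0r.
Qed.

End Projectors.

Section NegativeEigenvectors.
Context {R : realType} {H : hilbertType R}.
Implicit Types (x y z v w : H) (t m e C : R) (A T K P : {linear H -> H}).
Implicit Types (S N : set H).

Lemma rayleigh_inf T N : bounded_operator T -> subspace N ->
  (exists2 x, N x & rdot (T x) x < 0) ->
  exists m, [/\ m < 0, forall x, N x -> m * rnorm x ^+ 2 <= rdot (T x) x
    & forall e, 0 < e -> exists x, [/\ N x, rnorm x = 1 & rdot (T x) x < m + e]].
Proof.
move=> /bounded_rnorm[M M0 TM] [N0 _ NZ] [x0 Nx0 Tx0].
pose D := [set rdot (T x) x | x in [set x | N x /\ rnorm x = 1]].
have unit x : N x -> 0 < rnorm x -> D (rdot (T x) x / rnorm x ^+ 2).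
  move=> Nx xgt0; exists (((rnorm x)^-1)%:C *: x).
    split; first exact: NZ.
    by rewrite rnormZ ger0_norm ?invr_ge0 ?rnorm_ge0 // mulVf ?gt_eqF.
  by rewrite linearZ /= rdotZl rdotZr; field; rewrite gt_eqF.
have pos x : rdot (T x) x != 0 -> 0 < rnorm x.
  move=> Tx; rewrite lt_def rnorm_ge0 andbT; apply: contra Tx => /eqP x00.
  by rewrite (rnorm0_eq0 x00) rdot0r.
have Dinf : has_inf D.
  split; first by eexists; apply: (unit x0) => //; apply: pos; rewrite lt_eqF.
  exists (- M) => _ [x [_ x1] <-]; rewrite lerNl -rdotNl.
  rewrite (le_trans (ler_norm _)) // (le_trans (rdot_le _ _)) //.
  by rewrite x1 mulr1 rnormN (le_trans (TM _)) // x1 mulr1.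
have Dge a : D a -> inf D <= a by apply: ge_inf; case: Dinf.
exists (inf D); split=> [|x Nx|e e0].
- have x0gt0 : 0 < rnorm x0 by apply: pos; rewrite lt_eqF.
  apply: le_lt_trans (Dge _ (unit _ Nx0 x0gt0)) _.
  by rewrite pmulr_llt0 // invr_gt0 exprn_gt0.
- have := rnorm_ge0 x; rewrite le_eqVlt => /predU1P[x00|xgt0].
    by rewrite -x00 (rnorm0_eq0 (esym x00)) rdot0r expr0n /= mulr0.
  by rewrite -ler_pdivlMr ?exprn_gt0 //; apply: Dge; exact: unit.
- have [_ [x [Nx x1] <-] xe] := inf_adherent e0 Dinf.
  by exists x.
Qed.

Definition neg_eigenvectors T : set H :=
  [set x | exists2 l : R, l < 0 & T x = l%:C *: x].

Lemma neg_eigenvectors_invariant T x :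
  neg_eigenvectors T x -> neg_eigenvectors T (T x).
Proof. by move=> [l l0 Tx]; exists l => //; rewrite {1}Tx linearZ Tx. Qed.

(** A negative infimum of the form on the orthogonal of the negative
    eigenvectors would be attained at one of them, which would then be
    orthogonal to itself. *)
Lemma nonneg_orth_neg_eigenvectors T : bounded_operator T ->
  essentially_positive T ->
  forall x, orth (neg_eigenvectors T) x -> 0 <= rdot (T x) x.
Proof.
move=> Tb Tess x Nx; have Tself : selfadjoint T by case: Tess.
rewrite leNgt; apply/negP => Tx0.
have Nsub := orth_subspace (neg_eigenvectors T).
have [m [m0 mle minf]] := rayleigh_inf Tb Nsub (ex_intro2 _ _ x Nx Tx0).
have [u [Nu u1 Tu]] := attained_on_subspace Tb Tself Nsub
  (@orth_closed _ _ _) (orth_invariant Tself (@neg_eigenvectors_invariant T))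
  (ess_positive_estimate Tess m0) mle minf.
have : '[< u, u >] = 0 by apply: Nu; exists m.
move=> /rdot_inner0; rewrite -rnorm_sqr u1 expr1n => /eqP.
by rewrite oner_eq0.
Qed.

Definition sums S : set H :=
  [set x | exists2 s : seq H, (forall v, v \in s -> S v) & x = \sum_(v <- s) v].

Lemma sums_sub S x : S x -> sums S x.
Proof.
by move=> Sx; exists [:: x]; rewrite ?big_seq1 // => v; rewrite inE => /eqP ->.
Qed.

Lemma sums_subspace S : (forall (c : R[i]) x, S x -> S (c *: x)) -> subspace (sums S).
Proof.
move=> SZ; split.
- by exists [::]; rewrite ?big_nil.
- move=> _ _ [s Ss ->] [s' Ss' ->]; exists (s ++ s'); last by rewrite big_cat.
  by move=> v; rewrite mem_cat => /orP[/Ss|/Ss'].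
- move=> c _ [s Ss ->]; exists [seq c *: v | v <- s].
    by move=> _ /mapP[v /Ss Sv ->]; exact: SZ.
  by rewrite big_map scaler_sumr.
Qed.

Lemma sums_invariant T S : (forall x, S x -> S (T x)) ->
  forall x, sums S x -> sums S (T x).
Proof.
move=> ST _ [s Ss ->]; exists [seq T v | v <- s]; last by rewrite big_map linear_sum.
by move=> _ /mapP[v /Ss Sv ->]; exact: ST.
Qed.

(** For [x = sum_v v] with [T v = lam_v v], put
    [w = sum_v sqrt (- lam_v) v]. Then [<Tx, x> = - <w, w>]: eigenvectors with
    distinct eigenvalues are orthogonal, so in each nonzero term
    [<v, u>] of the double sums the two eigenvalues agree. This avoids grouping
    the summands by eigenvalue. *)
Lemma nonpos_sums_neg_eigenvectors T : selfadjoint T ->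
  forall x, sums (neg_eigenvectors T) x -> rdot (T x) x <= 0.
Proof.
move=> Tself _ [s Ss ->].
have eigenvalue v : exists l : R, neg_eigenvectors T v -> l < 0 /\ T v = l%:C *: v.
  have [[l l0 Tv]|nv] := pselect (neg_eigenvectors T v); first by exists l.
  by exists 0 => /nv.
have [lam lamP] := choice eigenvalue.
pose q v := Num.sqrt (- lam v).
pose w := \sum_(v <- s) (q v)%:C *: v.
suff -> : rdot (T (\sum_(v <- s) v)) (\sum_(v <- s) v) = - rdot w w.
  by rewrite oppr_le0 -rnorm_sqr sqr_ge0.
rewrite linear_sum !rdot_suml -sumrN big_seq [RHS]big_seq.
apply: eq_bigr => v /Ss /lamP[v0 Tv].
rewrite !rdot_sumr -sumrN big_seq [RHS]big_seq.
apply: eq_bigr => u /Ss /lamP[u0 Tu].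
have : rdot (T v) u = rdot v (T u) by rewrite /rdot Tself.
rewrite Tv Tu !rdotZl !rdotZr => /eqP; rewrite -subr_eq0 -mulrBl mulf_eq0.
rewrite subr_eq0 => /orP[/eqP vu|/eqP ->]; last by rewrite !mulr0 oppr0.
rewrite /q vu mulrA -expr2 sqr_sqrtr ?mulNr ?opprK //.
by rewrite oppr_ge0 ltW.
Qed.

Lemma nonpos_adherent T S : bounded_operator T ->
  (forall x, S x -> rdot (T x) x <= 0) ->
  forall x, adherent S x -> rdot (T x) x <= 0.
Proof.
move=> /bounded_rnorm[M M0 TM] Sle x Sx; apply/ler_addgt0Pr => e e0.
rewrite add0r; pose k := M * (2 * rnorm x + 1).
have k0 : 0 < k by rewrite mulr_gt0 //; have := rnorm_ge0 x; lra.
pose d := Num.min 1 (e / k).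
have d0 : 0 < d by rewrite lt_min ltr01 divr_gt0.
have [u Su xu] := Sx _ d0.
have d1 : d <= 1 by rewrite ge_min lexx.
have dk : d * k <= e by rewrite -ler_pdivlMr // ge_min lexx orbT.
have -> : rdot (T x) x = rdot (T u) u + (rdot (T (x - u)) x + rdot (T u) (x - u)).
  by rewrite linearB rdotBl rdotBr; ring.
have h1 : rdot (T (x - u)) x <= M * d * rnorm x.
  rewrite (le_trans (ler_norm _)) // (le_trans (rdot_le _ _)) //.
  by rewrite ler_wpM2r ?rnorm_ge0 // (le_trans (TM _)) // ler_wpM2l // ltW.
have un : rnorm u <= rnorm x + 1.
  rewrite -[u](subrK x) addrC (le_trans (rnormD _ _)) // lerD2l rnormB.
  exact: le_trans xu d1.
have h2 : rdot (T u) (x - u) <= M * (rnorm x + 1) * d.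
  rewrite (le_trans (ler_norm _)) // (le_trans (rdot_le _ _)) //.
  rewrite ler_pM ?rnorm_ge0 // (le_trans (TM _)) // ler_wpM2l //; exact: ltW.
have := Sle _ Su; move: dk; rewrite /k; lra.
Qed.

End NegativeEigenvectors.

(** * Finite-rank projections and Fredholm perturbations *)

Section Frames.
Context {R : realType} {H : hilbertType R}.
Implicit Types (x y z v w : H) (t m e C : R) (A T K P : {linear H -> H}).
Implicit Types (E F : seq H).

(** The orthogonal projection onto the span of [E], when [E] is
    orthonormal. *)
Definition frame_sum E x : H := \sum_(v <- E) '[< x, v >] *: v.

Lemma frame_sum_linear E : linear (frame_sum E).
Proof.
move=> a x y; rewrite /frame_sum scaler_sumr -big_split; apply: eq_bigr => v _ /=.
by rewrite linearDl linearZl_LR /= scalerDl scalerA.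
Qed.

HB.instance Definition _ E :=
  GRing.isLinear.Build _ _ _ _ (frame_sum E) (frame_sum_linear E).

Lemma frame_sum_selfadjoint E x y :
  '[< frame_sum E x, y >] = '[< x, frame_sum E y >].
Proof.
rewrite /frame_sum linear_sumlz linear_sumr.
apply: eq_bigr => v _; rewrite linearZl_LR linearZr_LR /= (innerC y v).
exact: mulrC.
Qed.

Lemma frame_idem E : (forall v, v \in E -> frame_sum E v = v) ->
  forall x, frame_sum E (frame_sum E x) = frame_sum E x.
Proof.
move=> EE x; rewrite {2 3}/frame_sum linear_sum big_seq [RHS]big_seq.
by apply: eq_bigr => w /EE wE; rewrite linearZ /= wE.
Qed.

(** Gram-Schmidt. That [frame_sum E] fixes [E] is the only form of
    orthogonality that is used. *)
Lemma orthonormal_frame F : exists E, [/\ forall v, v \in E -> rnorm v = 1,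
  forall v, v \in E -> frame_sum E v = v & forall v, v \in F -> frame_sum E v = v].
Proof.
elim: F => [|u F [E [E1 EE EF]]]; first by exists [::].
have [/eqP|u0] := eqVneq (u - frame_sum E u) 0.
  rewrite subr_eq0 => /eqP uE; exists E; split=> // v.
  by rewrite inE => /predU1P[->|/EF].
set z := u - frame_sum E u in u0.
have QE := frame_idem EE.
have Qz : frame_sum E z = 0 by rewrite /z linearB /= QE subrr.
have zn : rnorm z != 0 by apply: contra u0 => /eqP /rnorm0_eq0 ->.
pose e := ((rnorm z)^-1)%:C *: z.
have Qe : frame_sum E e = 0 by rewrite /e linearZ /= Qz scaler0.
have sum_cons v : frame_sum (e :: E) v = '[< v, e >] *: e + frame_sum E v.
  by rewrite /frame_sum big_cons.
have fix_cons v : frame_sum E v = v -> frame_sum (e :: E) v = v.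
  move=> vE; rewrite sum_cons vE -{1}vE frame_sum_selfadjoint.
  by rewrite Qe linear0r scale0r add0r.
have e1 : rnorm e = 1.
  by rewrite rnormZ ger0_norm ?invr_ge0 ?rnorm_ge0 // mulVf.
have ee : '[< e, e >] = 1 by rewrite -sqr_normE normC_rnorm e1 expr1n.
have ez : e = ((rnorm z)^-1)%:C *: z by [].
exists (e :: E); split=> v; rewrite inE => /predU1P[->|vE] //.
- exact: E1.
- by rewrite sum_cons ee scale1r Qe addr0.
- by rewrite fix_cons // EE.
- have -> : u = frame_sum E u + (rnorm z)%:C *: e.
    rewrite /e scalerA -rmorphM divff // scale1r /z.
    by rewrite addrC subrK.
  rewrite linearD /= fix_cons ?QE //; congr (_ + _).
  by rewrite linearZ /= sum_cons ee scale1r Qe addr0.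
- by rewrite fix_cons // EF.
Qed.

Lemma frame_orth E F : (forall v, v \in F -> frame_sum E v = v) ->
  forall x, orth [set` F] (x - frame_sum E x).
Proof.
move=> EF x v /= /EF vF; rewrite linearBl /= frame_sum_selfadjoint.
by rewrite vF subrr.
Qed.

Lemma frame_compl_le E : (forall v, v \in E -> frame_sum E v = v) ->
  forall x, rnorm (x - frame_sum E x) <= rnorm x.
Proof.
move=> EE x; rewrite -(ler_pXn2r (n := 2)) ?nnegrE ?rnorm_ge0 //.
rewrite -[X in _ <= rnorm X ^+ 2](subrK (frame_sum E x)).
rewrite [X in _ <= X]rnorm_pythagoras ?lerDl ?sqr_ge0 //.
by rewrite -frame_sum_selfadjoint linearB /= frame_idem // subrr linear0l.
Qed.

(** Split [x] into its components orthogonal to and inside the span of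
    [F]: on the latter, [K] is controlled by finitely many inner products. *)
Lemma compact_of_small_orth K : bounded_operator K ->
  (forall e, 0 < e -> exists F, forall x, orth [set` F] x ->
     rnorm (K x) <= e * rnorm x) ->
  compact_operator K.
Proof.
move=> Kb hK; have [M M0 KM] := bounded_rnorm Kb.
apply: compact_operator_l1seq => // e e0.
have [F hF] := hK _ e0; have [E [E1 EE EF]] := orthonormal_frame F.
exists M, E; split=> [|x]; first exact: ltW.
rewrite -{1}(subrK (frame_sum E x) x) linearD (le_trans (rnormD _ _)) // lerD //.
  apply: le_trans (hF _ (frame_orth EF x)) _.
  by rewrite ler_wpM2l ?(ltW e0) ?frame_compl_le.
rewrite (le_trans (KM _)) // ler_wpM2l ?(ltW M0) // /frame_sum /l1seq.
elim: E E1 {EE EF} => [|v E IH] E1; first by rewrite !big_nil rnorm0.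
rewrite !big_cons (le_trans (rnormD _ _)) // lerD //.
  rewrite (le_trans (rnorm_scale_le _ _)) // E1 ?mem_head // mulr1.
  by rewrite inner_rdot.
by apply: IH => u uE; rewrite E1 // inE uE orbT.
Qed.

End Frames.

Section FredholmCriteria.
Context {R : realType} {H : hilbertType R}.
Implicit Types (x y z v w : H) (t m e c C : R) (l : R[i]) (A B T K P : {linear H -> H}).
Implicit Types (E F s : seq H) (W : set H).

(** Coordinates are chosen one at a time, which makes inductions on the
    spanning list immediate. *)
Fixpoint lspan s : set H :=
  if s is v :: s' then [set x | exists a : R[i], lspan s' (x - a *: v)]
  else [set 0].

Lemma lspan_subspace s : subspace (lspan s).
Proof.
elim: s => [|v s [s0 sD sZ]] /=.
  by split=> [|_ _ -> ->|c _ ->]; rewrite ?addr0 ?scaler0.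
split=> [|x y [a xa] [b yb]|c x [a xa]].
- by exists 0; rewrite scale0r subr0.
- by exists (a + b); rewrite scalerDl opprD addrACA; exact: sD.
- by exists (c * a); rewrite -scalerA -scalerBr; exact: sZ.
Qed.

Lemma lspan_cons v s x : lspan s x -> lspan (v :: s) x.
Proof. by exists 0; rewrite scale0r subr0. Qed.

Lemma lspan_mem s v : v \in s -> lspan s v.
Proof.
elim: s => // u s IH; rewrite inE => /predU1P[->|/IH]; last exact: lspan_cons.
by exists 1; rewrite scale1r subrr; have [] := lspan_subspace s.
Qed.

Lemma lspan_sum s (r : seq H) (c : H -> R[i]) (f : H -> H) :
  (forall v, v \in r -> lspan s (f v)) -> lspan s (\sum_(v <- r) c v *: f v).
Proof.
have [s0 sD sZ] := lspan_subspace s.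
elim: r => [|v r IH] h; first by rewrite big_nil.
rewrite big_cons; apply/sD; first by apply/sZ/h; rewrite mem_head.
by apply: IH => u ur; apply: h; rewrite inE ur orbT.
Qed.

Lemma lspan_linear A s x : lspan s x -> lspan [seq A v | v <- s] (A x).
Proof.
elim: s x => [x /= ->|v s IH x [a xa]] /=; first by rewrite linear0.
by exists a; rewrite -linearZ -linearB; exact: IH.
Qed.

Lemma lspan_coord s x : lspan s x ->
  exists c : 'I_(size s) -> R[i], x = \sum_(i < size s) c i *: s`_i.
Proof.
suff h : lspan s x -> exists c : nat -> R[i], x = \sum_(i < size s) c i *: s`_i.
  by move=> /h[c ->]; exists (fun i => c i).
elim: s x => [x /= ->|v s IH x [a /IH[c xc]]].
  by exists (fun=> 0); rewrite big_ord0.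
exists (fun n => if n is n'.+1 then c n' else a).
by rewrite big_ord_recl /= -[LHS](subrK (a *: v)) xc addrC.
Qed.

(** Induction on [s = v :: s']: if some [w] in [W] has a nonzero coordinate
    along [v], every element of [W] is a multiple of [w] plus an element of
    [W] in the span of [s']; otherwise [W] lies in the span of [s']. *)
Lemma lspan_of_subspace W s : subspace W -> W `<=` lspan s ->
  exists s', (forall v, v \in s' -> W v) /\ W `<=` lspan s'.
Proof.
elim: s W => [|v s IH] W Wsub Ws; first by exists [::].
have [W0 WD WZ] := Wsub; have [s0 sD sZ] := lspan_subspace s.
have [[w [Ww [a [a0 wa]]]]|nw] :=
    pselect (exists w, W w /\ exists a, a != 0 /\ lspan s (w - a *: v)).
  have W'sub : subspace (W `&` lspan s).
    split=> [|x y [Wx sx] [Wy sy]|c x [Wx sx]]; split=> //.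
    - exact: WD.
    - exact: sD.
    - exact: WZ.
    - exact: sZ.
  have [s' [s'W Ws']] := IH _ W'sub (@subIsetr _ _ _).
  exists (w :: s'); split=> [u|x Wx].
    by rewrite inE => /predU1P[->|/s'W[]].
  have [b xb] := Ws _ Wx; exists (b / a); apply: Ws'; split.
    by rewrite -scaleN1r scalerA; apply/WD/WZ.
  have -> : x - (b / a) *: w = (x - b *: v) + (- (b / a)) *: (w - a *: v).
    rewrite scalerBr scalerA mulNr divfK // !scaleNr opprK.
    by rewrite [in RHS](addrC _ (b *: v)) subrKA.
  by apply/sD/sZ.
apply: IH => // x Wx; have [a xa] := Ws _ Wx.
have [a0|a0] := eqVneq a 0; first by move: xa; rewrite a0 scale0r subr0.
by case: nw; exists x; split=> //; exists a.
Qed.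

Lemma finite_dim_quotient_seq W W' s : (forall v, v \in s -> W v) ->
  (forall x, W x -> exists2 y, lspan s y & W' (x - y)) ->
  finite_dim_quotient W W'.
Proof.
move=> sW h; exists (size s), (fun i => s`_i); split=> [i|x /h[y /lspan_coord[c ->]]].
  by apply: sW; rewrite mem_nth.
by exists c.
Qed.

(** With [G] the inverse of [B], a vector [x] with [A x = 0] equals
    [G (B x - A x)], hence lies in the span of [G s]; and [y = B G y] differs
    from [A G y] by an element of the span of [s]. *)
Lemma fredholm_finite_rank_perturbation A B s : invertible_operator B ->
  (forall x, lspan s (A x - B x)) -> fredholm A.
Proof.
move=> [G [_ GB BG]] AB; have [s0 sD sZ] := lspan_subspace s.
split.
  have kersub : subspace [set x | A x = 0].
    split=> [|x y /= Ax Ay|c x /= Ax]; first by rewrite /= linear0.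
      by rewrite linearD Ax Ay addr0.
    by rewrite linearZ /= Ax scaler0.
  have [x /= Ax|s' [s'ker hs']] := lspan_of_subspace (s := [seq G v | v <- s]) kersub.
    rewrite -[x]GB; apply: lspan_linear.
    by rewrite -[B x]opprK -scaleN1r; apply/sZ; rewrite -[- _]add0r -Ax.
  apply: (@finite_dim_quotient_seq _ _ s') => // x /hs' xs'.
  by exists x => //=; rewrite subrr.
apply: (@finite_dim_quotient_seq _ _ s) => // y _.
exists (y - A (G y)); last by exists (G y) => //; rewrite opprB addrC subrK.
by rewrite -{1}[y]BG -opprB -scaleN1r; apply/sZ.
Qed.

Lemma l1dot_le x y : l1dot x y <= 2 * (rnorm x * rnorm y).
Proof.
have := rdot_le x y; have := rdot_le x ('i *: y); rewrite rnormZi /l1dot; lra.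
Qed.

Lemma coercive_invertible A c : bounded_operator A -> 0 < c ->
  (forall x, c * rnorm x ^+ 2 <= l1dot (A x) x) -> invertible_operator A.
Proof.
move=> Ab c0 hA; apply: (@bounded_below_invertible _ _ A (c / 2)) => //.
- by rewrite divr_gt0.
- move=> x; have := rnorm_ge0 x; rewrite le_eqVlt => /predU1P[<-|x0].
    by rewrite mulr0 rnorm_ge0.
  rewrite -(ler_pM2r x0); have := hA x; have := l1dot_le (A x) x; lra.
- move=> y hy; apply: rnorm0_eq0; apply/eqP; rewrite -sqrf_eq0 eq_le sqr_ge0 andbT.
  rewrite -(pmulr_rle0 _ c0) (le_trans (hA y)) // /l1dot.
  by have := hy y; rewrite inner_rdot => -[-> ->]; rewrite normr0 addr0.
Qed.

Lemma shift_bounded A l : bounded_operator A -> bounded_operator (shift A l).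
Proof.
move=> /bounded_rnorm[M M0 AM].
apply: (@rnorm_bounded _ _ _ (M + (`|complex.Re l| + `|complex.Im l|))) => x.
by rewrite shiftE (le_trans (rnormD _ _)) // rnormN mulrDl lerD ?rnorm_scale_le.
Qed.

(** For a self-adjoint [A] the form of [A - l] at [x] has imaginary part
    [- Im l |x|^2] and real part at least [(m - Re l) |x|^2], so one of the two
    makes [A - l] coercive. *)
Lemma shift_invertible A m l : bounded_operator A -> selfadjoint A ->
  (forall x, m * rnorm x ^+ 2 <= rdot (A x) x) ->
  complex.Im l != 0 \/ complex.Re l < m -> invertible_operator (shift A l).
Proof.
move=> Ab Aself Am hl.
have ReA x : rdot (shift A l x) x = rdot (A x) x - complex.Re l * rnorm x ^+ 2.
  rewrite shiftE rdotBl (rdotC (_ *: _)) rdotZc rnorm_sqr.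
  by have := sqr_normE x; rewrite normC_rnorm -rmorphXn inner_rdot => -[_ <-];
    rewrite mulr0 addr0.
have ImA x : rdot (shift A l x) ('i *: x) = - complex.Im l * rnorm x ^+ 2.
  have Ax : rdot (A x) ('i *: x) = 0.
    have : '[< A x, x >] = ('[< A x, x >])^*%C by rewrite -innerC Aself.
    rewrite inner_rdot => -[] /eqP.
    by rewrite -subr_eq0 opprK -mulr2n mulrn_eq0 => /eqP.
  rewrite shiftE rdotBl Ax sub0r mulNr; congr (- _).
  rewrite /rdot linearZl_LR linearZr_LR /= mulrA -sqr_normE normC_rnorm -rmorphXn.
  by case: (l) => a b /=; ring.
have [c [c0 hc]] : exists c : R, 0 < c /\
    forall x, c * rnorm x ^+ 2 <= l1dot (shift A l x) x.
  case: hl => [l0|lm].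
    exists `|complex.Im l|; rewrite normr_gt0; split=> // x.
    rewrite /l1dot ImA mulNr normrN normrM (ger0_norm (sqr_ge0 _)).
    by rewrite lerDr.
  exists (m - complex.Re l); rewrite subr_gt0; split=> // x.
  rewrite /l1dot (@le_trans _ _ `|rdot (shift A l x) x|) ?lerDl //.
  by rewrite ReA (le_trans _ (ler_norm _)) // mulrBl lerD2r.
exact: coercive_invertible (shift_bounded l Ab) c0 hc.
Qed.

End FredholmCriteria.

(** * The equivalence *)

Section EssentialPositivity.
Context {R : realType} {H : hilbertType R}.
Implicit Types (x y z v w : H) (t m e c C : R) (l : R[i]) (A B T K P : {linear H -> H}).
Implicit Types (E F s : seq H) (S W : set H).

Lemma ge0_complexPn l : ~ (0 <= l) -> complex.Im l != 0 \/ complex.Re l < 0.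
Proof.
rewrite lecE /= => /negP; rewrite negb_and -ltNge => /orP[|]; by [left|right].
Qed.

(** The form of the compression [P T P] of [T] to the orthogonal of [F] is
    bounded below by [m] everywhere, since [m <= 0]. Its shift is therefore
    invertible, and [T - P T P] has finite rank. *)
Lemma ess_bounded_below_fredholm T m l : bounded_operator T -> selfadjoint T ->
  ess_bounded_below T m -> m <= 0 ->
  complex.Im l != 0 \/ complex.Re l < m -> fredholm (shift T l).
Proof.
move=> Tb Tself [F hF] m0 hl; have [M M0 TM] := bounded_rnorm Tb.
have [E [E1 EE EF]] := orthonormal_frame F.
pose P : {linear H -> H} := idfun \- frame_sum E.
have PE x : P x = x - frame_sum E x by [].
have Pself x y : '[< P x, y >] = '[< x, P y >].
  by rewrite !PE linearBl linearBr /= frame_sum_selfadjoint.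
have Ple x : rnorm (P x) <= rnorm x by exact: frame_compl_le.
pose B : {linear H -> H} := P \o (T \o P).
have BE x : B x = P (T (P x)) by [].
have Bb : bounded_operator B.
  apply: (@rnorm_bounded _ _ _ M) => x; rewrite BE.
  apply: le_trans (Ple _) _; apply: le_trans (TM _) _.
  by rewrite ler_wpM2l ?(ltW M0).
have Bself : selfadjoint B.
  by move=> x y; rewrite !BE Pself Tself Pself.
have Bm x : m * rnorm x ^+ 2 <= rdot (B x) x.
  rewrite /rdot BE Pself -/(rdot _ _).
  apply: le_trans (hF _ (frame_orth EF x)).
  rewrite ler_wnM2l // ler_pXn2r ?nnegrE ?rnorm_ge0 //; exact: Ple.
apply: (@fredholm_finite_rank_perturbation _ _ _ (shift B l) ([seq T v | v <- E] ++ E)).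
  exact: shift_invertible Bb Bself Bm hl.
move=> x; have [s0 sD sZ] := lspan_subspace ([seq T v | v <- E] ++ E).
have -> : shift T l x - shift B l x = T (frame_sum E x) + frame_sum E (T (P x)).
  have -> : frame_sum E x = x - P x by rewrite PE opprB addrC subrK.
  have -> : T (x - P x) = T x - T (P x) by exact: linearB.
  rewrite !shiftE opprB addrA addrNK BE (PE (T (P x))) opprB -addrA.
  by congr (_ + _); exact: addrC.
apply/sD.
  rewrite /frame_sum linear_sum.
  under eq_bigr do rewrite linearZ.
  by apply: lspan_sum => v vE; apply: lspan_mem; rewrite mem_cat map_f.
by apply: lspan_sum => v vE; apply: lspan_mem; rewrite mem_cat vE orbT.
Qed.

Lemma positive_of_rdot_ge0 A : bounded_operator A -> selfadjoint A ->
  (forall x, 0 <= rdot (A x) x) -> positive A.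
Proof.
move=> Ab Aself A0; split=> // l /= nl; apply: contrapT => /ge0_complexPn hl.
apply: nl; apply: (shift_invertible Ab Aself _ hl) => x.
by rewrite mul0r.
Qed.

(** A negative infimum [m] of the form would be attained at an eigenvector,
    since invertibility of [A - m] gives the required estimate; but an
    eigenvector contradicts this invertibility. *)
Lemma positive_rdot_ge0 A : bounded_operator A -> positive A ->
  forall x, 0 <= rdot (A x) x.
Proof.
move=> Ab [Aself Aspec] x; rewrite leNgt; apply/negP => Ax.
have Tsub : subspace (setT : set H) by split.
have [m [m0 mle minf]] := rayleigh_inf Ab Tsub (ex_intro2 _ _ x I Ax).
have [G [/bounded_rnorm[M M0 GM] GK _]] : invertible_operator (shift A m%:C).
  by apply: contrapT => /Aspec /=; rewrite ler0c leNgt m0.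
have [//|//||u [_ u1 Au]] := attained_on_subspace Ab Aself Tsub _ _ _ mle minf.
  exists M, [::]; split=> // y.
  by rewrite /l1seq big_nil addr0 -{1}[y]GK GM.
move: u1; rewrite -[u]GK shiftE Au subrr linear0 rnorm0 => /eqP.
by rewrite eq_sym oner_eq0.
Qed.

(** [K = - T P] removes the part of [T] on the closed span of the
    eigenvectors with negative eigenvalue. *)
Lemma compact_perturbation_of_ess_positive T : bounded_operator T ->
  essentially_positive T ->
  exists2 K : {linear H -> H}, compact_operator K & positive (T \+ K).
Proof.
move=> Tb Tess; have Tself : selfadjoint T by case: Tess.
have [M M0 TM] := bounded_rnorm Tb.
pose N := neg_eigenvectors T; pose S := sums N.
have NT x : N x -> N (T x) by exact: neg_eigenvectors_invariant.
have ST x : S x -> S (T x) by exact: sums_invariant.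
have Ssub : subspace S.
  apply: sums_subspace => c x [m m0 Tx]; exists m => //.
  by rewrite linearZ /= Tx !scalerA mulrC.
have [P [Pself PS PO Ple]] := orth_projector Ssub.
have TS x : adherent S (T (P x)) by exact: adherent_invariant.
have adhO x y : adherent S x -> orth S y -> '[< x, y >] = 0.
  by move=> Sx; rewrite -orth_adherent => Sy; apply: inner0C; exact: Sy.
(* [P] commutes with [T], since the range of [P] is invariant. *)
have TPself x y : '[< T (P x), y >] = '[< x, T (P y) >].
  have h u v : '[< T (P u), v >] = '[< T (P u), P v >].
    by rewrite -{1}(subrK (P v) v) linearDr /= (adhO _ (v - P v)) ?add0r.
  by rewrite h Tself [RHS]innerC h -innerC.
pose K : {linear H -> H} := \- (T \o P).
have KE x : K x = - T (P x) by [].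
clearbody K.
have KM x : rnorm (K x) <= M * rnorm x.
  by rewrite KE rnormN (le_trans (TM _)) // ler_wpM2l ?(ltW M0).
have Kb : bounded_operator K by exact: rnorm_bounded KM.
have Kself : selfadjoint K.
  by move=> x y; rewrite !KE linearNl linearNr /= TPself.
have rK x : rdot (K x) x = - rdot (T (P x)) (P x).
  rewrite KE rdotNl -{2}(subrK (P x) x) rdotDr.
  by rewrite (rdot_inner0 (adhO _ _ (TS x) (PO x))) add0r.
have Kpos x : 0 <= rdot (K x) x.
  rewrite rK oppr_ge0; apply: nonpos_adherent Tb _ _ (PS x).
  exact: nonpos_sums_neg_eigenvectors.
exists K.
  apply: compact_of_small_orth => // e e0.
  have d0 : 0 < e ^+ 2 / M by rewrite divr_gt0 ?exprn_gt0.
  have [F hF] := ess_positive_bounded_below Tb Tess d0.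
  (* [P x] is orthogonal to [F] as soon as [x] is orthogonal to [P F]. *)
  exists [seq P v | v <- F] => x xF.
  rewrite -(ler_pXn2r (n := 2)) ?nnegrE ?mulr_ge0 ?rnorm_ge0 ?(ltW e0) //.
  have Tsub : subspace (setT : set H) by split.
  apply: le_trans (psd_rnorm_le Kself (ltW M0) KM Tsub (fun z _ => Kpos z) I I) _.
  have PxF : orth [set` F] (P x).
    by move=> v /= vF; rewrite Pself; apply: xF; rewrite /= map_f.
  have : rdot (K x) x <= e ^+ 2 / M * rnorm (P x) ^+ 2.
    by rewrite rK lerNl -mulNr; exact: hF.
  have : e ^+ 2 / M * rnorm (P x) ^+ 2 <= e ^+ 2 / M * rnorm x ^+ 2.
    by rewrite ler_wpM2l ?(ltW d0) // ler_pXn2r ?nnegrE ?rnorm_ge0.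
  move=> h1 /le_trans /(_ h1); rewrite -(ler_pM2l M0) => /le_trans; apply.
  rewrite le_eqVlt; apply/orP; left; apply/eqP; field; by rewrite gt_eqF.
have TKE x : T x + K x = T (x - P x) by rewrite KE linearB.
apply: positive_of_rdot_ge0.
- apply: (@rnorm_bounded _ _ _ (M + M)) => x.
  by apply: le_trans (rnormD (T x) (K x)) _; rewrite mulrDl lerD.
- move=> x y; suff : '[< T x + K x, y >] = '[< x, T y + K y >] by [].
  by rewrite linearDl linearDr /= Tself Kself.
- move=> x; suff : 0 <= rdot (T x + K x) x by [].
  rewrite TKE -[X in rdot _ X](subrK (P x)) rdotDr.
  rewrite [X in _ + X]rdot_inner0 ?addr0.
    apply: nonneg_orth_neg_eigenvectors Tb Tess _ _ => v Nv.
    by apply: PO; exact: sums_sub.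
  by apply/inner0C/adhO => //; exact: orth_invariant.
Qed.

(** If [y] is [d]-close to [K x], then
    [|Kx|^2 <= |K| d + |<x, K y>|] for a unit vector [x]; finitely many [y]
    suffice for all such [x], and along the net the second term tends to 0 for
    each of them. *)
Lemma compact_weakly_null (I : Type) (le : I -> I -> Prop) (x : I -> H) K :
  directed le -> (forall a, `|x a| = 1) -> weak_cvg le x 0 ->
  compact_operator K -> selfadjoint K ->
  forall e, 0 < e -> tails le [set a | rnorm (K (x a)) <= e].
Proof.
move=> [[a0] lerefl letrans ledir] x1 xw cK Kself e e0.
have xr a : rnorm (x a) = 1.
  by have := x1 a; rewrite normC_rnorm => /(congr1 (@complex.Re R)).
have [M M0 KM] := bounded_rnorm (proj1 cK).
pose d := e ^+ 2 / 2 / M.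
have d0 : 0 < d by rewrite !divr_gt0 ?exprn_gt0.
have [Y hY] := compact_operator_net cK d0.
have eY : exists a, forall b, le a b -> forall y, y \in Y ->
    `|rdot (x b) (K y)| <= e ^+ 2 / 2.
  elim: Y {hY} => [|y Y [a ha]]; first by exists a0.
  have := xw (K y) (ball '[< (0 : H), K y >] (e ^+ 2 / 2)%:C).
  case; first by apply: nbhsx_ballx; rewrite ltcR divr_gt0 ?exprn_gt0.
  move=> a' ha'; have [c [ac a'c]] := ledir a a'.
  exists c => b cb z; rewrite inE => /predU1P[->|zY]; last first.
    by apply: ha => //; exact: letrans cb.
  have := ha' b (letrans _ _ _ a'c cb).
  rewrite /= -ball_normE /= linear0l sub0r normrN => h.
  rewrite -lecR; apply: le_trans (normc_ge_Re _) _; exact: ltW.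
have [a ha] := eY; exists a => b /ha hb /=.
rewrite -(ler_pXn2r (n := 2)) ?nnegrE ?rnorm_ge0 ?(ltW e0) // rnorm_sqr.
have [|y yY yK] := hY (x b); first by rewrite xr.
rewrite -{2}[K (x b)](subrK y) rdotDr.
have : rdot (K (x b)) y <= e ^+ 2 / 2.
  by rewrite (le_trans (ler_norm _)) // /rdot Kself; exact: hb.
have : rdot (K (x b)) (K (x b) - y) <= M * d.
  rewrite (le_trans (ler_norm _)) // (le_trans (rdot_le _ _)) //.
  by rewrite ler_pM ?rnorm_ge0 ?(ltW yK) // (le_trans (KM _)) // xr mulr1.
have -> : M * d = e ^+ 2 / 2 by rewrite /d mulrC divfK ?gt_eqF.
lra.
Qed.

Lemma net_liminf_ge0 (I : Type) (le : I -> I -> Prop) (u : I -> R) :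
  (forall e, 0 < e -> tails le [set a | - e <= u a]) ->
  (0 <= net_liminf le (fun a => (u a)%:E))%E.
Proof.
move=> hu; apply/lee_addgt0Pr => e e0.
have [a ha] := hu _ e0.
rewrite -leeBlDr // sub0e.
apply: (@le_trans _ _ (ereal_inf ((fun a => (u a)%:E) @` [set b | le a b]))).
  by apply: le_ereal_inf_tmp => _ [b /ha hb <-]; rewrite -EFinN lee_fin.
by apply: ereal_sup_ubound; exists a.
Qed.

Lemma net_liminf_of_compact_perturbation T : bounded_operator T -> selfadjoint T ->
  (exists2 K : {linear H -> H}, compact_operator K & positive (T \+ K)) ->
  forall (I : Type) (le : I -> I -> Prop) (x : I -> H),
    directed le -> (forall a, `|x a| = 1) -> weak_cvg le x 0 ->
    (0 <= net_liminf le (fun a => (rdot (T (x a)) (x a))%:E))%E.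
Proof.
move=> Tb Tself [K cK TKpos] I le x le_dir x1 xw.
have [M M0 TM] := bounded_rnorm Tb; have [M' M'0 KM] := bounded_rnorm (proj1 cK).
have TKb : bounded_operator (T \+ K).
  apply: (@rnorm_bounded _ _ _ (M + M')) => y.
  by rewrite /= (le_trans (rnormD _ _)) // mulrDl lerD.
have Kself : selfadjoint K.
  move=> y z; have [/(_ y z) + _] := TKpos.
  by rewrite /= linearDl linearDr /= Tself => /addrI.
apply: net_liminf_ge0 => e e0.
have [a ha] := compact_weakly_null le_dir x1 xw cK Kself e0.
exists a => b /ha /= Kx.
have := positive_rdot_ge0 TKb TKpos (x b); rewrite /= rdotDl.
have := le_trans (ler_norm _) (rdot_le (K (x b)) (x b)).
have -> : rnorm (x b) = 1.
  by have := x1 b; rewrite normC_rnorm => /(congr1 (@complex.Re R)).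
lra.
Qed.

(** If the bound fails, each finite list [F] has a unit vector [x F]
    orthogonal to it at which the form is below [- e]. Ordering the lists by
    inclusion makes [x] a net, and it is weakly null because [<x F, y> = 0] as
    soon as [y] belongs to [F]. *)
Lemma ess_bounded_below_of_net_liminf T e : 0 < e ->
  (forall (I : Type) (le : I -> I -> Prop) (x : I -> H),
    directed le -> (forall a, `|x a| = 1) -> weak_cvg le x 0 ->
    (0 <= net_liminf le (fun a => (rdot (T (x a)) (x a))%:E))%E) ->
  ess_bounded_below T (- e).
Proof.
move=> e0 hnet; apply: contrapT => nT.
have bad F : exists x, [/\ orth [set` F] x, rnorm x = 1 & rdot (T x) x < - e].
  have [x [xF xe]] : exists x, orth [set` F] x /\ rdot (T x) x < - e * rnorm x ^+ 2.
    apply: contrapT => /forallNP h; apply: nT; exists F => x xF.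
    by rewrite leNgt; apply/negP => xe; apply: (h x).
  have x0 : 0 < rnorm x.
    rewrite lt_def rnorm_ge0 andbT; apply/eqP => x0; move: xe.
    by rewrite (rnorm0_eq0 x0) rdot0r rnorm0 expr0n /= mulr0 ltxx.
  exists (((rnorm x)^-1)%:C *: x); split.
  - by have [_ _] := orth_subspace [set` F]; apply.
  - by rewrite rnormZ ger0_norm ?invr_ge0 ?rnorm_ge0 // mulVf ?gt_eqF.
  - rewrite linearZ /= rdotZl rdotZr mulrA -expr2 exprVn mulrC.
    by rewrite ltr_pdivrMr ?exprn_gt0.
have [x xP] := choice bad.
pose le F F' := {subset F <= F'}.
have x1 F : `|x F| = 1 by have [_ h _] := xP F; rewrite normC_rnorm h.
have dir : directed le.
  split=> [|F|F F' F'' h h' v /h /h'|F F'] //; first exact: (inhabits [::]).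
  by exists (F ++ F'); split=> v; rewrite mem_cat => ->; rewrite ?orbT.
have xw : weak_cvg le x 0.
  move=> y B /nbhs_singleton; rewrite linear0l => B0; exists [:: y] => F yF /=.
  by have [xF _ _] := xP F; rewrite xF //; apply: yF; rewrite mem_head.
have := hnet _ le x dir x1 xw; rewrite leNgt => /negP; apply.
apply: (@le_lt_trans _ _ (- e)%:E); last by rewrite lte_fin oppr_lt0.
apply: ge_ereal_sup => _ [F _ <-].
apply: ge_ereal_inf; exists (rdot (T (x F)) (x F))%:E; first by exists F.
by have [_ _ h] := xP F; rewrite lee_fin ltW.
Qed.

Lemma ess_positive_of_ess_bounded_below T : bounded_operator T -> selfadjoint T ->
  (forall e, 0 < e -> ess_bounded_below T (- e)) -> essentially_positive T.
Proof.
move=> Tb Tself hT; split=> // l /= nl; apply: contrapT => /ge0_complexPn hl.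
apply: nl.
have [e [e0 hle]] : exists e, 0 < e /\ (complex.Im l != 0 \/ complex.Re l < - e).
  case: hl => hl; first by exists 1; split=> //; left.
  by exists (- complex.Re l / 2); split; [|right]; lra.
by apply: (ess_bounded_below_fredholm Tb Tself (hT _ e0) _ hle); rewrite oppr_le0 ltW.
Qed.

End EssentialPositivity.

Theorem theorem3 (R : realType) (H : hilbertType R) (T : {linear H -> H})
    (T_bounded : bounded_operator T) (T_selfadjoint : selfadjoint T) :
  [<->
    essentially_positive T;
    exists2 K : {linear H -> H}, compact_operator K & positive (T \+ K);
    forall (I : Type) (le : I -> I -> Prop) (x : I -> H),
      directed le -> (forall a, `|x a| = 1) -> weak_cvg le x 0 ->
      (0 <= net_liminf le (fun a => (complex.Re '[< T (x a), x a >])%:E))%E ].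
Proof.
tfae.
- exact: compact_perturbation_of_ess_positive.
- exact: net_liminf_of_compact_perturbation.
- move=> hnet; apply: ess_positive_of_ess_bounded_below => // e e0.
  exact: ess_bounded_below_of_net_liminf.
Qed.
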